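(* Let $a,b>0$ be fixed, let $\{\mathscr{C}_s(a,b):s>0\}$ be the Lamé family, and let $L_{(s)}$ denote the perimeter of $\mathscr{C}_s(a,b)$. Then $$L_{(s)}\ge L_{(1)}=4\sqrt{a^2+b^2}\qquad\text{for every } s>0.$$ The minimum is attained only at $s=1$; equivalently, the rhombus $\mathscr{C}_1(a,b)$ is the unique global minimizer of the perimeter within the Lamé family. Moreover, $s=1$ is a strict local minimum of the Abel-regularized analytic representation of the two hypergeometric branches, i.e. of the function of $s$ given by the Abel-regularized value of $L^+_{(s)}$ for $s>1$, by the Abel-regularized value of $L^-_{(s)}$ for $0<s<1$, and by their common limiting value at $s=1$.
   Context: For $a,b,s>0$, the superellipse (Lamé curve) $\mathscr{C}_s(a,b)$ is the closed plane curve given in polar coordinates by $r=r_{a,b}(\theta)=\left(\frac{|\cos\theta|^s}{a^s}+\frac{|\sin\theta|^s}{b^s}\right)^{-1/s}$, $0\le\theta<2\pi$; its perimeter is its total arc length. For $s=1$ it is the rhombus with vertices $(\pm a,0)$, $(0,\pm b)$. The hypergeometric branches are $$L_{(s)}^{\pm}=\frac{2\sqrt{a^2+b^2}}{\pm(s-1)}\sum_{k=0}^{\infty}\frac{(-1)^k(\alpha)_k}{k!\,u_k^{\pm}}\left[{}_2F_1\left(-\tfrac12,1;u_k^{\pm}+1;\tfrac{b^2}{a^2+b^2}\right)+{}_2F_1\left(-\tfrac12,1;u_k^{\pm}+1;\tfrac{a^2}{a^2+b^2}\right)\right],$$ with upper sign for $s>1$ and lower sign for $0<s<1$, where $\alpha=1+\frac1s$,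 $u_k^{+}=\frac{sk+1}{2(s-1)}$, $u_k^{-}=\frac{s(k+1)}{2(1-s)}$, $(q)_k=\Gamma(q+k)/\Gamma(q)$ and ${}_2F_1$ is the Gauss hypergeometric function. The Abel-regularized value of a branch is obtained by replacing $(-1)^k$ by $(-\varepsilon)^k$, $0<\varepsilon<1$, and taking the limit $\varepsilon\to1^-$. *)

(* Defs.v *)
From HB Require Import structures.
From mathcomp Require Import all_boot all_order all_algebra.
From mathcomp Require Import all_classical all_reals all_analysis.
From mathcomp Require Import measurable_realfun lra ring.

Set Implicit Arguments.
Unset Strict Implicit.
Unset Printing Implicit Defensive.

Import Order.TTheory GRing.Theory Num.Theory.
Import numFieldNormedType.Exports.

Local Open Scope classical_set_scope.
Local Open Scope ring_scope.

Section curves.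
Context {R : realType}.
Implicit Types (p q : R * R) (f : R -> R * R) (u v : R) (s : seq R).

Definition euclidean_dist p q : R :=
  Num.sqrt ((p.1 - q.1) ^+ 2 + (p.2 - q.2) ^+ 2).

(* As in numfun.v, the partition u < t_1 < ... < t_n = v of `[u, v] is given
   by s = [:: t_1; ...; t_n]. *)
Definition polygonal_length f u s : R :=
  \sum_(0 <= i < size s)
    euclidean_dist (f (nth u (u :: s) i)) (f (nth u (u :: s) i.+1)).

Definition arc_length f u v : \bar R :=
  ereal_sup [set (polygonal_length f u s)%:E | s in itv_partition u v].

Variables a b s : R.

Definition superellipse_radius (theta : R) : R :=
  (`|cos theta| `^ s / a `^ s + `|sin theta| `^ s / b `^ s) `^ (- s^-1).

Definition superellipse (theta : R) : R * R :=
  (superellipse_radius theta * cos theta,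
   superellipse_radius theta * sin theta).

Definition perimeter : \bar R := arc_length superellipse 0 (2 * pi).

End curves.

Section pochhammer.
Context {R : realType}.
Implicit Types (p q x t : R).
Local Notation mu := (@lebesgue_measure R).

(* Written as the product q (q + 1) ... (q + k - 1) because it is also needed
   at q = -1/2, outside the domain of Euler's integral. For q >= 1 it is
   Gamma (q + k) / Gamma q by pochhammer_Gamma. *)
Definition pochhammer q (k : nat) : R := \prod_(i < k) (q + i%:R).

Definition Gamma q : R :=
  (\int[lebesgue_measure]_(t in `[0, +oo[) (t `^ (q - 1) * expR (- t)))%R.

Let g p t : R := t `^ p * expR (- t).

Let g_ge0 p t : 0 <= g p t.
Proof. by rewrite mulr_ge0 ?powR_ge0 ?expR_ge0. Qed.

Let measurable_g p (D : set R) : measurable_fun D (g p).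
Proof.
apply: measurable_funTS; apply: measurable_funM.
  exact: measurable_powR.
by apply: measurableT_comp => //; exact: measurable_expR.
Qed.

Let measurable_E p (D : set R) : measurable_fun D (fun t => (g p t)%:E).
Proof. by apply/measurable_EFinP; exact: measurable_g. Qed.

Let measurable_Eg p c (D : set R) :
  measurable_fun D (fun t => (c * g p t)%:E).
Proof.
by apply/measurable_EFinP; apply: measurable_funM.
Qed.

Let is_derive_g p t : 0 < t ->
  is_derive t 1 (g p) (p * g (p - 1) t - g p t).
Proof.
move=> t0; rewrite /g.
have dN : is_derive t 1 (fun t : R => expR (- t)) (- expR (- t)).
  rewrite -[- expR _]mulN1r.
  rewrite mulrC; apply: (@is_derive1_comp _ expR -%R t).
have dp := is_derive1_powR p t0.
have H := is_deriveM dp dN.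
apply: (is_derive_eq H); rewrite /GRing.scale /=; ring.
Qed.

Let continuous_g p t : 0 < t -> {for t, continuous (g p)}.
Proof.
move=> /(is_derive_g p) [d _]; apply: differentiable_continuous.
exact/derivable1_diffP.
Qed.

Let cvg_g0 p : 0 <= p -> g p t @[t --> 0^'+] --> g p 0.
Proof.
move=> p0; apply: cvgM; last first.
  apply: cvg_at_right_filter.
  by apply: continuous_comp; [exact: opp_continuous|exact: continuous_expR].
have [->|pn0] := eqVneq p 0.
  by under eq_fun do rewrite powRr0; rewrite powRr0; exact: cvg_cst.
by rewrite powR0//; apply: powR_cvg0; rewrite lt_neqAle eq_sym pn0.
Qed.

Let g_bound p : 0 <= p -> exists C, 0 <= C /\
  forall t, 0 <= t -> g p t <= C * expR (- (t / 2)).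
Proof.
move=> p0; have [m pm] : exists m : nat, p <= m.+1%:R.
  exists (Num.bound p); apply: ltW; rewrite (lt_le_trans (archi_boundP p0))//.
  by rewrite ler_nat.
exists (2 ^+ m.+1 * (m.+1)`!%:R); split; first by rewrite mulr_ge0// exprn_ge0.
move=> t t0; rewrite /g.
rewrite (_ : - t = - (t / 2) + - (t / 2)); last lra.
rewrite expRD mulrA ler_wpM2r ?expR_ge0//.
rewrite expRN ler_pdivrMr ?expR_gt0//.
have ht : 0 <= t / 2 by lra.
have := expR_ge1Dxn m ht.
set f := (m.+1)`!%:R => h.
have f1 : 1 <= f :> R by rewrite ler1n fact_gt0.
have c1 : 1 <= (2 : R) ^+ m.+1 by rewrite exprn_ege1//; lra.
have e0 := expR_ge0 (t / 2).
apply: (@le_trans _ _ (1 + t ^+ m.+1)).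
  have [t1|t1] := leP t 1.
    rewrite (@le_trans _ _ 1)// ?lerDl ?exprn_ge0//.
    rewrite (_ : 1 = 1 `^ p :> R); last (by rewrite powR1); apply: ge0_ler_powR => //; rewrite ?nnegrE//; lra.
  rewrite (@le_trans _ _ (t ^+ m.+1))// ?lerDr ?ler01//.
  by rewrite -powR_mulrn//; apply: ler_powR => //; exact: ltW.
rewrite (le_trans _ (ler_wpM2l _ h))//; last by rewrite mulr_ge0//; lra.
rewrite expr_div_n mulrDr mulr1 lerD//; first by nra.
rewrite (_ : _ * _ * _ = t ^+ m.+1)//; field.
by rewrite expf_neq0// andbT lt0r_neq0//; lra.
Qed.

Let cvg_expRN2 : expR (- (t / 2)) @[t --> +oo] --> (0 : R).
Proof.
under eq_fun do rewrite mulrC.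
apply: (@cvg_comp _ _ _ (fun t => 2^-1 * t : R) (fun t => expR (- t)) _ +oo).
  by apply: gt0_cvgMry => //; exact: cvg_id.
exact: cvgr_expR.
Qed.

Let cvg_gy p : 0 <= p -> g p t @[t --> +oo] --> 0.
Proof.
move=> /g_bound[C [C0 hC]].
apply: (@squeeze_cvgr _ _ _ _ (fun=> 0) (fun t => C * expR (- (t / 2)))).
- near=> t; rewrite g_ge0 hC//.
- exact: cvg_cst.
- by rewrite -(mulr0 C); apply: cvgMr.
Unshelve. all: by end_near.
Qed.

Let iG p (D : set R) : \bar R := \int[mu]_(t in D) (g p t)%:E.

Let iG_ge0 p D : (0 <= iG p D)%E.
Proof. by apply: integral_ge0 => t _; rewrite lee_fin. Qed.

Let iG_fin p : 0 <= p -> iG p `[0, +oo[ \is a fin_num.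
Proof.
move=> p0; have [C [C0 hC]] := g_bound p0.
rewrite ge0_fin_numE//.
apply: (@le_lt_trans _ _ (\int[mu]_(t in `[0%R, +oo[)
    (C * expR (- (t / 2)))%:E)%E).
  apply: ge0_le_integral => //.
  - by move=> t _; rewrite lee_fin.
  - exact: measurable_E.
  - apply/measurable_EFinP; apply: measurable_funM => //.
    apply: measurable_funTS; apply: measurableT_comp => //.
    by apply: measurableT_comp => //; apply: measurable_funM.
  - by move=> t; rewrite /= in_itv/= andbT lee_fin; exact: hC.
have dF t : is_derive t 1 (fun t => (-2 * C) * expR (- (t / 2)))
    (C * expR (- (t / 2))).
  have dN : is_derive t 1 (fun t : R => - (t / 2)) (- 2^-1).
    under eq_fun do rewrite mulrC.
    by apply: is_deriveN; rewrite -[X in is_derive _ _ _ X]mulr1; apply: is_deriveZ.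
  have H := is_deriveZ (-2 * C) (@is_derive1_comp _ expR _ t _ _ (is_derive_expR _) dN).
  by apply: (is_derive_eq H); rewrite /GRing.scale/=; field.
have cE : continuous (fun t : R => expR (- (t / 2))).
  move=> t; apply: continuous_comp; last exact: continuous_expR.
  by apply: cvgN; apply: cvgMl.
rewrite (@ge0_continuous_FTC2y _ _
  (fun t => (-2 * C) * expR (- (t / 2))) 0 0)//.
- by rewrite -EFinB ltry.
- by move=> t t0; rewrite mulr_ge0// expR_ge0.
- by apply: continuous_subspaceT => t; apply: cvgMr; exact: cE.
- by rewrite -(mulr0 (-2 * C)); apply: cvgMr.
- by apply: cvg_at_right_filter; apply: cvgMr; exact: cE.
- by move=> t _; rewrite derive1E; apply: (@derive_val _ _ _ _ _ _ _ (dF t)).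
Qed.

Let iG_rec p : 0 <= p -> (iG (p + 1) `[0%R, +oo[ = (p + 1)%:E * iG p `[0%R, +oo[)%E.
Proof.
move=> p0; set x := p + 1; have x0 : 0 < x by rewrite /x; lra.
have xp : x - 1 = p by rewrite /x; lra.
pose d t := x * g p t - g x t.
have dE t : 0 < t -> d t = (x - t) * g p t.
  move=> t0; rewrite /d /g /x powRD; last by rewrite gt_eqF ?implybT.
  by rewrite powRr1 ?ltW//; ring.
have dx t : 0 < t -> is_derive t 1 (g x) (d t).
  by move=> t0; rewrite /d -{1}xp; exact: is_derive_g.
have cd t : 0 < t -> {for t, continuous d}.
  by move=> t0; apply: cvgB; [apply: cvgMr|]; exact: continuous_g.
have cd0 : d t @[t --> 0^'+] --> d 0.
  by apply: cvgB; [apply: cvgMr|]; apply: cvg_g0 => //; exact: ltW.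
have md (D : set R) : measurable_fun D d.
  by apply: measurable_funB => //; apply: measurable_funM.
have g0 : g x 0 = 0 by rewrite /g powR0 ?mul0r ?gt_eqF.
have IA : (\int[mu]_(t in `[0%R, x]) (x * g p t)%:E =
    iG x `[0%R, x] + (g x x)%:E)%E.
  rewrite -[X in (_ + X)%E](_ : \int[mu]_(t in `[0%R, x]) (d t)%:E = _)%E; last first.
    rewrite (@continuous_FTC2 _ _ (g x))// ?g0 ?sube0//.
    - apply/continuous_within_itvP => //; split => //.
        by move=> t; rewrite in_itv/= => /andP[t0 _]; exact: cd.
      exact/cvg_at_left_filter/cd.
    - split.
      + by move=> t; rewrite in_itv/= => /andP[/dx[]].
      + exact/cvg_g0/ltW.
      + exact/cvg_at_left_filter/continuous_g.
    - move=> t; rewrite in_itv/= => /andP[/dx H _].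
      by rewrite derive1E derive_val.
  rewrite -ge0_integralD//.
  - by apply: eq_integral => t _; rewrite -EFinD /d addrC subrK.
  - by move=> t _; rewrite lee_fin.
  - exact: measurable_E.
  - move=> t; rewrite /= in_itv/= le_eqVlt => /andP[/predU1P[<- _|t0 tx]].
      by rewrite lee_fin /d g0 subr0 mulr_ge0// ltW.
    by rewrite lee_fin dE// mulr_ge0// subr_ge0.
  - by apply/measurable_EFinP; exact: md.
have IB : (iG x `[x, +oo[ =
    \int[mu]_(t in `[x, +oo[) (x * g p t)%:E + (g x x)%:E)%E.
  rewrite -[X in (_ + X)%E](_ : \int[mu]_(t in `[x, +oo[) (- d t)%:E = _)%E; last first.
    rewrite (@ge0_continuous_FTC2y _ _ (- g x) x 0)//.
    - by rewrite -EFinB opprK add0r.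
    - move=> t xt; have t0 := lt_le_trans x0 xt.
      by rewrite dE// -mulNr mulr_ge0// opprB subr_ge0.
    - apply/continuous_within_itvcyP; split.
        move=> t; rewrite in_itv/= andbT => xt.
        by apply: cvgN; apply: cd; exact: lt_trans xt.
      by apply: cvgN; exact/cvg_at_right_filter/cd.
    - by rewrite -oppr0; apply: cvgN; apply: cvg_gy; exact: ltW.
    - by move=> t xt; apply: derivableN; have [] := dx t (lt_trans x0 xt).
    - by apply: cvgN; exact/cvg_at_right_filter/continuous_g.
    - move=> t; rewrite in_itv/= andbT => xt.
      have H := is_deriveN (dx t (lt_trans x0 xt)).
      by rewrite derive1E derive_val.
  rewrite -ge0_integralD//.
  - by apply: eq_integral => t _; rewrite -EFinD /d; congr EFin; ring.
  - by move=> t _; rewrite lee_fin mulr_ge0// ltW.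
  - exact: measurable_Eg.
  - move=> t; rewrite /= in_itv/= andbT => xt; have t0 := lt_le_trans x0 xt.
    by rewrite lee_fin dE// -mulNr mulr_ge0// opprB subr_ge0.
  - by apply/measurable_EFinP; apply: measurableT_comp => //; exact: md.
have split_itv : `[0%R, +oo[%classic = `[0%R, x] `|` `]x, +oo[ :> set R.
  apply/seteqP; split => t /=; rewrite !in_itv/= ?andbT.
    by move=> t0; case: (leP t x) => tx; [left; rewrite t0|right].
  by case=> [/andP[]//|/(lt_trans x0)/ltW].
have disj : [disjoint `[0%R, x] & `]x, +oo[ : set R].
  apply/disj_setPS => t /=; rewrite !in_itv/= andbT => -[/andP[_ tx]].
  by rewrite ltNge tx.
rewrite -ge0_integralZl_EFin//; last 3 first.
- by move=> t _; rewrite lee_fin.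
- exact: measurable_E.
- exact: ltW.
under [RHS]eq_integral do rewrite -EFinM.
rewrite /iG split_itv !ge0_integral_setU//; last 4 first.
- exact: measurable_Eg.
- by move=> t _; rewrite lee_fin mulr_ge0// ltW.
- exact: measurable_E.
- by move=> t _; rewrite lee_fin.
rewrite !integral_itv_obnd_cbnd; [|exact: measurable_Eg|exact: measurable_E].
rewrite -/(iG x `[x, +oo[) -/(iG x `[0, x]) IB IA.
by rewrite addeA addeAC.
Qed.

Let iG_gt0 p : 0 <= p -> (0 < iG p `[0%R, +oo[)%E.
Proof.
move=> p0; apply: (@lt_le_trans _ _ (\int[mu]_(t in `[1%R, 2%R]) (expR (-2))%:E)%E).
  rewrite integral_cst//= lebesgue_measure_itv/= lte_fin ltr1n/= -EFinB -EFinM.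
  by rewrite lte_fin mulr_gt0 ?expR_gt0//; lra.
apply: (@le_trans _ _ (iG p `[1%R, 2%R])).
  apply: ge0_le_integral => //.
  - exact: measurable_E.
  - move=> t /=; rewrite in_itv/= lee_fin => /andP[t1 t2].
    rewrite /g -[leLHS]mul1r ler_pM// ?expR_ge0//.
      by rewrite (_ : 1 = 1 `^ p :> R); last (by rewrite powR1); apply: ge0_ler_powR => //; rewrite ?nnegrE//; lra.
    by rewrite ler_expR; lra.
apply: ge0_subset_integral => //.
- exact: measurable_E.
- by move=> t _; rewrite lee_fin.
- by move=> t /=; rewrite !in_itv/= andbT => /andP[t1 _]; lra.
Qed.

Lemma Gamma_gt0 q : 1 <= q -> 0 < Gamma q.
Proof.
move=> q1; apply: fine_gt0; rewrite iG_gt0 ?subr_ge0//=.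
by rewrite -ge0_fin_numE ?iG_ge0// iG_fin ?subr_ge0.
Qed.

Lemma GammaD1 q : 1 <= q -> Gamma (q + 1) = q * Gamma q.
Proof.
move=> q1; have q0 : 0 <= q - 1 by rewrite subr_ge0.
have := iG_rec q0; rewrite subrK /Gamma /Rintegral => H.
rewrite addrK -[X in X = _]/(fine (iG q _)) H.
by rewrite fineM//; exact: iG_fin.
Qed.

Lemma pochhammer_Gamma q n : 1 <= q ->
  pochhammer q n = Gamma (q + n%:R) / Gamma q.
Proof.
move=> q1; have g0 := lt0r_neq0 (Gamma_gt0 q1).
apply: (canRL (mulfK g0)); elim: n => [|n IH].
  by rewrite /pochhammer big_ord0 mul1r addr0.
rewrite /pochhammer big_ord_recr/= mulrAC -/(pochhammer q n) IH.
by rewrite mulrC -GammaD1 -?natr1 ?addrA// (le_trans q1)// lerDl.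
Qed.

End pochhammer.

Section hypergeometric_branches.
Context {R : realType}.

Definition hypergeometric_2F1 (a b c z : R) : R :=
  limn (series (fun n : nat =>
    pochhammer a n * pochhammer b n / (pochhammer c n * n`!%:R) * z ^+ n)).

Variables a b s : R.

(* The power (-1)^k of the branches is generalized to x^k, so that the
   Abel regularization is the substitution x = - e. *)
Definition branch_term (u : nat -> R) (x : R) (k : nat) : R :=
  x ^+ k * pochhammer (1 + s^-1) k / (k`!%:R * u k) *
  (hypergeometric_2F1 (- 2^-1) 1 (u k + 1) (b ^+ 2 / (a ^+ 2 + b ^+ 2)) +
   hypergeometric_2F1 (- 2^-1) 1 (u k + 1) (a ^+ 2 / (a ^+ 2 + b ^+ 2))).

Definition u_plus (k : nat) : R := (s * k%:R + 1) / (2 * (s - 1)).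

Definition u_minus (k : nat) : R := s * (k%:R + 1) / (2 * (1 - s)).

Definition L_plus (x : R) : R :=
  2 * Num.sqrt (a ^+ 2 + b ^+ 2) / (s - 1) *
  limn (series (branch_term u_plus x)).

Definition L_minus (x : R) : R :=
  2 * Num.sqrt (a ^+ 2 + b ^+ 2) / - (s - 1) *
  limn (series (branch_term u_minus x)).

(* [L_plus] and [L_minus] use the total operator [limn]: these predicates say
   that the regularized series and their limit at 1 really converge. *)
Definition abel_converges (v : R -> nat -> R) (L : R -> R) : Prop :=
  (forall e, 0 < e < 1 -> cvgn (series (v (- e)))) /\
  cvg (L (- e) @[e --> 1^'-]).

Definition L_plus_abel_converges : Prop :=
  abel_converges (branch_term u_plus) L_plus.

Definition L_minus_abel_converges : Prop :=
  abel_converges (branch_term u_minus) L_minus.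

Definition L_plus_abel : R := lim (L_plus (- e) @[e --> 1^'-]).

Definition L_minus_abel : R := lim (L_minus (- e) @[e --> 1^'-]).

End hypergeometric_branches.

(* The two branches, completed by the value l at s = 1; only used for s > 0. *)
Definition L_abel {R : realType} (a b l s : R) : R :=
  if 1 < s then L_plus_abel a b s
  else if s < 1 then L_minus_abel a b s
  else l.

Definition strict_local_min {R : realType} (f : R -> R) (x : R) : Prop :=
  \forall y \near x^', f x < f y.

(* Main.v *)
(* Perimeter.  In each quadrant the curve is monotone, so chords there are
   controlled by the increments of y/b - x/a; this bounds the length from above,
   exactly for s = 1.  From below, the length is at least that of the inscribed
   polygon through the four vertices and one more point, which for s <> 1 lies
   off the rhombus, whence strictness.

   Branches.  The binomial series converges uniformly on compact subsets of
   ]-1, 1[, hence can be integrated termwise.  Used once with exponent 1/2 it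
   turns 2F1(-1/2, 1; u+1; z), u = (p+1)/r, into
     (p+1) int_0^1 x^p sqrt(1 - z + z x^r) dx;
   used again with exponent -(1+1/s) it sums the branches to
     4 sqrt(a^2+b^2) c int_0^1 (1 + e x^q)^(-1-1/s) g(x^(2 rho)) dx,
     g(w) = sqrt(1 - z + z w) + sqrt(z + (1 - z) w),  z = b^2/(a^2+b^2),
   with (q, rho, c) = (s, s - 1, 1) for s > 1 and (1, 1/s - 1, 1/s) for s < 1.
   As e -> 1 the integral converges by monotonicity.  The bounds
     1 + t + z(1-z)(1-t)^2 <= g(t^2) <= 2  on [0, 1]
   leave integrals with elementary primitives: they squeeze both branches to
   4 sqrt(a^2+b^2) at s = 1 and keep them strictly above it for s <> 1. *)
Require Import Defs.
From HB Require Import structures.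
From mathcomp Require Import all_boot all_order all_algebra.
From mathcomp Require Import all_classical all_reals all_analysis.
From mathcomp Require Import measurable_realfun lra ring.

Set Implicit Arguments.
Unset Strict Implicit.
Unset Printing Implicit Defensive.

Import Order.TTheory GRing.Theory Num.Theory.
Import numFieldNormedType.Exports.

Local Open Scope classical_set_scope.
Local Open Scope ring_scope.

(** * Arc length of superellipses *)

Section plane_curves.
Context {R : realType}.
Implicit Types (f g V : R -> R * R) (p q r : R * R) (u v m x y : R).

(** Cauchy-Schwarz: by Lagrange's identity the squares differ by the square of a determinant. *)
Lemma dot_le_sqrt (x1 y1 x2 y2 : R) :
  x1 * x2 + y1 * y2 <=
  Num.sqrt (x1 ^+ 2 + y1 ^+ 2) * Num.sqrt (x2 ^+ 2 + y2 ^+ 2).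
Proof.
rewrite -sqrtrM ?addr_ge0 ?sqr_ge0// (le_trans (ler_norm _))// -sqrtr_sqr.
rewrite ler_wsqrtr// -subr_ge0.
rewrite (_ : _ - _ = (x1 * y2 - x2 * y1) ^+ 2) ?sqr_ge0//; ring.
Qed.

(** Equality in Cauchy-Schwarz would force the determinant in Lagrange's identity to vanish. *)
Lemma dot_lt_sqrt (x1 y1 x2 y2 : R) : x1 * y2 != y1 * x2 ->
  x1 * x2 + y1 * y2 <
  Num.sqrt (x1 ^+ 2 + y1 ^+ 2) * Num.sqrt (x2 ^+ 2 + y2 ^+ 2).
Proof.
move=> ne; have h := dot_le_sqrt x1 y1 x2 y2.
rewrite lt_neqAle h andbT; apply: contra_neq ne => /(congr1 (fun x => x ^+ 2)).
rewrite exprMn !sqr_sqrtr ?addr_ge0 ?sqr_ge0// => e; apply/eqP.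
rewrite -subr_eq0 -sqrf_eq0; apply/eqP.
rewrite (_ : _ ^+ 2 = (x1 ^+ 2 + y1 ^+ 2) * (x2 ^+ 2 + y2 ^+ 2) -
  (x1 * x2 + y1 * y2) ^+ 2); first by rewrite e subrr.
ring.
Qed.

Lemma euclidean_dist_ge0 p q : 0 <= euclidean_dist p q.
Proof. exact: sqrtr_ge0. Qed.

Lemma euclidean_dist_le p q (c : R) : 0 <= c ->
  (p.1 - q.1) ^+ 2 + (p.2 - q.2) ^+ 2 <= c ^+ 2 -> euclidean_dist p q <= c.
Proof.
by move=> c0 h; rewrite -[leRHS]ger0_norm// -sqrtr_sqr ler_wsqrtr.
Qed.

Lemma euclidean_dist_triangle q p r :
  euclidean_dist p r <= euclidean_dist p q + euclidean_dist q r.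
Proof.
apply: euclidean_dist_le; first by rewrite addr_ge0 ?euclidean_dist_ge0.
rewrite [leRHS]sqrrD /euclidean_dist !sqr_sqrtr ?addr_ge0 ?sqr_ge0//.
have := dot_le_sqrt (p.1 - q.1) (p.2 - q.2) (q.1 - r.1) (q.2 - r.2).
set s := _ * Num.sqrt _ => h; rewrite -subr_ge0.
rewrite (_ : _ - _ = 2 * (s - ((p.1 - q.1) * (q.1 - r.1) +
  (p.2 - q.2) * (q.2 - r.2)))); first by rewrite mulr_ge0// subr_ge0.
rewrite -/s; ring.
Qed.

(** The increments of [T] telescope along a partition, so [C] bounds every polygonal length; bounds
    of this form can be glued along adjacent arcs. *)
Definition chord_bound f u v (C : R) : Prop := exists T : R -> R,
  (forall x y, u <= x -> x <= y -> y <= v ->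
    euclidean_dist (f x) (f y) <= T y - T x) /\ T v - T u <= C.

Lemma arc_length_le f u v C : chord_bound f u v C ->
  (arc_length f u v <= C%:E)%E.
Proof.
move=> [T [fT TC]]; apply: ub_ereal_sup => _ [s [us /eqP sv] <-].
rewrite lee_fin (le_trans _ TC)// -sv {TC}.
have {sv}: last u s <= v by rewrite sv.
(* The starting point is freed for the induction on the partition, and the last point is only kept
   below [v]. *)
suff H w : u <= w -> path <%R w s -> last w s <= v ->
    polygonal_length f w s <= T (last w s) - T w by exact: H.
elim: s w {us} => [|t s ih] w uw /=.
  by move=> _ _; rewrite /polygonal_length big_nil subrr.
move=> /andP[wt ts] sv; have ut := le_trans uw (ltW wt).
rewrite /polygonal_length/= big_nat_recl//=.
(* The head of an increasing list is at most its last element. *)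
have tv : t <= v.
  apply: le_trans sv; move: ts; rewrite (path_sortedE lt_trans) => /andP[+ _].
  by elim/last_ind: s {ih} => // s z _; rewrite last_rcons all_rcons => /andP[/ltW].
apply: (@le_trans _ _ ((T t - T w) + (T (last t s) - T t))); last by lra.
apply: lerD; first exact: fT uw (ltW wt) tv.
apply: le_trans (ih _ ut ts sv); rewrite le_eqVlt; apply/orP; left; apply/eqP.
apply: eq_big_nat => i /= si.
(* The two sums differ only in the default value of [nth], never reached by these indices. *)
by rewrite !(@set_nth_default _ _ w t) //= ltnW// ltnS.
Qed.

Lemma chord_bound_cat m f u v C D : u <= m -> m <= v ->
  chord_bound f u m C -> chord_bound f m v D -> chord_bound f u v (C + D).
Proof.
move=> um mv [T [fT TC]] [W [fW WD]].
(* [W] is shifted to agree with [T] at [m]; a chord across [m] is split there by the triangle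
   inequality. *)
exists (fun x => if x <= m then T x else W x - W m + T m); split; last first.
  rewrite um; case: (leP v m) => [vm|_]; last by lra.
  have vE : v = m by apply/eqP; rewrite eq_le vm.
  by move: WD; rewrite vE; lra.
move=> x y ux xy yv; case: (leP y m) => [ym|my].
  by rewrite (le_trans xy ym); exact: fT.
case: (leP x m) => [xm|mx].
  have h1 := fT _ _ ux xm (lexx _); have h2 := fW _ _ (lexx _) (ltW my) yv.
  have := euclidean_dist_triangle (f m) (f x) (f y); lra.
have := fW _ _ (ltW mx) xy yv; lra.
Qed.

Definition rotate p : R * R := (- p.2, p.1).

Lemma euclidean_dist_rotate p q :
  euclidean_dist (rotate p) (rotate q) = euclidean_dist p q.
Proof. by congr Num.sqrt; rewrite /=; ring. Qed.

Lemma chord_bound_rotate f g (c : R) u v C :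
  (forall x, f (x + c) = rotate (g x)) ->
  chord_bound g u v C -> chord_bound f (u + c) (v + c) C.
Proof.
move=> fg [T [gT TC]]; exists (fun x => T (x - c)); rewrite !addrK; split=> //.
move=> x y ux xy yv; rewrite -(subrK c x) -(subrK c y) !fg euclidean_dist_rotate.
rewrite !addrK; apply: gT; lra.
Qed.

End plane_curves.

(** * Perimeter of superellipses: upper and lower bounds *)

Section superellipse.
Context {R : realType}.
Implicit Types a b s x y t u v : R.

Definition lame_point a b s x y : Prop :=
  [/\ 0 <= x, 0 <= y & (x / a) `^ s + (y / b) `^ s = 1].

Lemma superellipse_denom_gt0 a b s t : 0 < a -> 0 < b -> 0 < s ->
  0 < `|cos t| `^ s / a `^ s + `|sin t| `^ s / b `^ s.
Proof.
move=> a0 b0 s0.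
have [c0|c0] := eqVneq (cos t) 0.
  rewrite ltr_wpDl ?divr_ge0 ?powR_ge0// divr_gt0 ?powR_gt0// normr_gt0.
  apply/eqP => s1; have := cos2Dsin2 t.
  by rewrite c0 s1 expr0n/= addr0 => /esym/eqP; rewrite oner_eq0.
by rewrite ltr_wpDr ?divr_ge0 ?powR_ge0// divr_gt0 ?powR_gt0 ?normr_gt0.
Qed.

Lemma superellipse_radius_gt0 a b s t : 0 < a -> 0 < b -> 0 < s ->
  0 < superellipse_radius a b s t.
Proof. by move=> a0 b0 s0; exact/powR_gt0/superellipse_denom_gt0. Qed.

Lemma superellipse_lame_point a b s t : 0 < a -> 0 < b -> 0 < s ->
  0 <= cos t -> 0 <= sin t ->
  lame_point a b s (superellipse a b s t).1 (superellipse a b s t).2.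
Proof.
move=> a0 b0 s0 ct st; have r0 := ltW (superellipse_radius_gt0 t a0 b0 s0).
split; [exact: mulr_ge0|exact: mulr_ge0|rewrite /=].
rewrite !powRM ?invr_ge0 ?mulr_ge0 ?(ltW a0) ?(ltW b0)//.
have VE c : 0 < c -> c^-1 `^ s = (c `^ s)^-1.
  by move=> c0; rewrite -[c^-1]powR_inv1 ?ltW// -powRrM mulN1r powRN.
rewrite !VE// -!mulrA -mulrDr.
(* Restoring the absolute values makes the sum the one inside the radius, whose power of exponent
   [s] is the inverse of that sum. *)
rewrite -[in cos t `^ s](ger0_norm ct) -[in sin t `^ s](ger0_norm st).
rewrite /superellipse_radius -powRrM mulNr mulVf ?gt_eqF// powR_inv1.
  by rewrite mulVf// gt_eqF// superellipse_denom_gt0.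
exact/ltW/superellipse_denom_gt0.
Qed.

Lemma superellipse0 a b s : 0 < a -> 0 < s -> superellipse a b s 0 = (a, 0).
Proof.
move=> a0 s0; rewrite /superellipse /superellipse_radius cos0 sin0 normr0 normr1.
rewrite powR0 ?gt_eqF// powR1 mul0r addr0 mulr0 mulr1 div1r -powRN -powRrM.
by rewrite mulrNN divff ?gt_eqF// powRr1// ltW.
Qed.

(** A quarter turn swaps the semi-axes, which reduces every quadrant to the first. *)
Lemma superellipse_rotate a b s t :
  superellipse a b s (t + pi / 2) = rotate (superellipse b a s t).
Proof.
have -> : superellipse a b s (t + pi / 2) =
    (superellipse_radius b a s t * - sin t, superellipse_radius b a s t * cos t).
  rewrite /superellipse /superellipse_radius cosDpihalf sinDpihalf normrN.
  by rewrite [in LHS]addrC.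
by rewrite mulrN.
Qed.

Lemma superellipse_pihalf a b s : 0 < b -> 0 < s ->
  superellipse a b s (pi / 2) = (0, b).
Proof.
move=> b0 s0; rewrite -[pi / 2]add0r superellipse_rotate superellipse0//.
by rewrite /rotate/= oppr0.
Qed.

(* The curve is decreasing in the first quadrant, so the polar angle alone
   orders its points. *)
Lemma lame_point_mono a b s x1 y1 x2 y2 : 0 < a -> 0 < b -> 0 < s ->
  lame_point a b s x1 y1 -> lame_point a b s x2 y2 ->
  x2 * y1 <= x1 * y2 -> x2 <= x1 /\ y1 <= y2.
Proof.
move=> a0 b0 s0 [x10 y10 e1] [x20 y20 e2] cr.
have mono c u v : 0 < c -> 0 <= u -> u < v -> (u / c) `^ s < (v / c) `^ s.
  move=> c0 u0 uv; apply: gt0_ltr_powR => //; last by rewrite ltr_pM2r// invr_gt0.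
    by rewrite nnegrE divr_ge0// ltW.
  by rewrite nnegrE divr_ge0// ltW// (le_lt_trans u0).
have monoW c u v : 0 < c -> 0 <= u -> u <= v -> (u / c) `^ s <= (v / c) `^ s.
  by move=> c0 u0; rewrite le_eqVlt => /predU1P[->//|uv]; exact/ltW/mono.
split.
- rewrite leNgt; apply/negP => x12; have /(_ a a0 x10) := mono _ _ _ _ _ x12.
  (* If [y1 <= y2], the two sums of powers could not both be 1; if [y2 < y1], the cross product has
     the wrong sign. *)
  have [y12|y21] := leP y1 y2.
    by have := monoW _ _ _ b0 y10 y12; lra.
  by move=> _; nra.
- rewrite leNgt; apply/negP => y21; have := mono _ _ _ b0 y20 y21.
  have [x21|x12] := leP x2 x1.
    by have := monoW _ _ _ a0 x20 x21; lra.
  by move=> _; nra.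
Qed.

(** Since [y / b - x / a] grows from -1 to 1 over the first quadrant, the quarter arc has length at
    most [2 * c]. The constant is left free to serve both a crude bound for all [s] and the sharp
    one at [s = 1]. *)
Definition lame_chord_bound a b s (c : R) : Prop :=
  forall x1 y1 x2 y2, lame_point a b s x1 y1 -> lame_point a b s x2 y2 ->
    x2 <= x1 -> y1 <= y2 ->
    euclidean_dist (x1, y1) (x2, y2) <= c * ((x1 - x2) / a + (y2 - y1) / b).

Lemma superellipse_chord_bound_quadrant a b s (c : R) :
  0 < a -> 0 < b -> 0 < s -> lame_chord_bound a b s c ->
  chord_bound (superellipse a b s) 0 (pi / 2) (2 * c).
Proof.
move=> a0 b0 s0 dc.
have pi0 := @pi_gt0 R.
have quad t : 0 <= t -> t <= pi / 2 -> 0 <= cos t /\ 0 <= sin t.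
  move=> t0 tp; split; first by apply: cos_ge0_pihalf; lra.
  by apply: sin_ge0_pi; lra.
pose f := superellipse a b s.
exists (fun t => c * ((f t).2 / b - (f t).1 / a)); split.
  move=> u v u0 uv vp.
  have [cu su] := quad _ u0 (le_trans uv vp).
  have [cv sv] := quad _ (le_trans u0 uv) vp.
  have pu := superellipse_lame_point a0 b0 s0 cu su.
  have pv := superellipse_lame_point a0 b0 s0 cv sv.
  have [|h1 h2] := lame_point_mono a0 b0 s0 pu pv.
    rewrite /= -subr_ge0.
    set ru := superellipse_radius _ _ _ u; set rv := superellipse_radius _ _ _ v.
    (* The cross product of two points in polar form: its sign is that of the sine of the angle
       between them. *)
    rewrite (_ : _ - _ = ru * rv * sin (v - u)); last by rewrite sinB; ring.
    rewrite mulr_ge0//; first by rewrite mulr_ge0// powR_ge0.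
    apply: sin_ge0_pi; lra.
  have := dc _ _ _ _ pu pv h1 h2; rewrite -!surjective_pairing /f.
  move: (superellipse a b s u) (superellipse a b s v) => p q /le_trans; apply.
  by rewrite le_eqVlt; apply/orP; left; apply/eqP; ring.
rewrite /f superellipse0// superellipse_pihalf//= !mul0r subr0 sub0r.
rewrite !divff ?gt_eqF//; lra.
Qed.

Lemma perimeter_le a b s (c : R) : 0 < a -> 0 < b -> 0 < s ->
  lame_chord_bound a b s c -> lame_chord_bound b a s c ->
  (perimeter a b s <= (8 * c)%:E)%E.
Proof.
move=> a0 b0 s0 cab cba; have pi0 := @pi_gt0 R.
have qab := superellipse_chord_bound_quadrant a0 b0 s0 cab.
have qba := superellipse_chord_bound_quadrant b0 a0 s0 cba.
rewrite -[pi / 2]add0r in qab qba.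
have rot a' b' u v C : chord_bound (superellipse b' a' s) u v C ->
    chord_bound (superellipse a' b' s) (u + pi / 2) (v + pi / 2) C.
  exact/chord_bound_rotate/superellipse_rotate.
apply: arc_length_le.
(* Iterated addition makes the endpoints convertible to those produced by successive rotations. *)
pose q n : R := iter n (+%R^~ (pi / 2)) 0.
have -> : 2 * pi = q 4%N by rewrite /q/=; field.
have -> : 8 * c = 2 * c + (2 * c + (2 * c + 2 * c)) by ring.
apply: (@chord_bound_cat _ (q 1%N)); [rewrite /q/=; lra..| |].
  exact: qab.
apply: (@chord_bound_cat _ (q 2%N)); [rewrite /q/=; lra..| |].
  exact: (rot _ _ _ _ _ qba).
apply: (@chord_bound_cat _ (q 3%N)); [rewrite /q/=; lra..| |].
  exact: (rot _ _ _ _ _ (rot _ _ _ _ _ qab)).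
exact: (rot _ _ _ _ _ (rot _ _ _ _ _ (rot _ _ _ _ _ qba))).
Qed.

(** A hypotenuse is at most the sum of its legs [a * u] and [b * v]. This crude bound serves to show
    that the perimeter is finite. *)
Lemma lame_chord_bound_add a b s : 0 < a -> 0 < b ->
  lame_chord_bound a b s (a + b).
Proof.
move=> a0 b0 x1 y1 x2 y2 _ _ x21 y12.
set u := (x1 - x2) / a; set v := (y2 - y1) / b.
have u0 : 0 <= u by rewrite divr_ge0 ?subr_ge0// ltW.
have v0 : 0 <= v by rewrite divr_ge0 ?subr_ge0// ltW.
apply: euclidean_dist_le => /=; first by rewrite mulr_ge0// ?addr_ge0// ltW.
have -> : x1 - x2 = a * u by rewrite mulrC divfK ?gt_eqF.
have -> : y1 - y2 = - (b * v) by rewrite mulrC divfK ?gt_eqF// opprB.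
have au := mulr_ge0 (ltW a0) u0; have av := mulr_ge0 (ltW a0) v0.
have bu := mulr_ge0 (ltW b0) u0; have bv := mulr_ge0 (ltW b0) v0.
rewrite sqrrN (le_trans (y := (a * u + b * v) ^+ 2))//; last first.
  by apply: lerXn2r; rewrite ?nnegrE; lra.
rewrite -subr_ge0 (_ : _ - _ = 2 * ((a * u) * (b * v))); last by ring.
by apply: mulr_ge0 => //; apply: mulr_ge0.
Qed.

(** On a side of the rhombus both normalized increments equal the same [v], and the chord has length
    exactly [v] times the side; the factor 1/2 compensates for [v + v]. *)
Lemma lame_chord_bound1 a b : 0 < a -> 0 < b ->
  lame_chord_bound a b 1 (Num.sqrt (a ^+ 2 + b ^+ 2) / 2).
Proof.
move=> a0 b0 x1 y1 x2 y2 [x10 y10 e1] [x20 y20 e2] x21 y12.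
move: e1 e2; rewrite !powRr1 ?divr_ge0 ?(ltW a0) ?(ltW b0)// => e1 e2.
have hx : x1 - x2 = a * ((y2 - y1) / b).
  have -> : (y2 - y1) / b = x1 / a - x2 / a by lra.
  by field; rewrite gt_eqF.
have hy : y1 - y2 = - (b * ((y2 - y1) / b)) by field; rewrite gt_eqF.
rewrite hx; set v := (y2 - y1) / b in hx hy *.
have v0 : 0 <= v by rewrite divr_ge0 ?subr_ge0// ltW.
rewrite [a * v]mulrC mulfK ?gt_eqF//.
have -> : Num.sqrt (a ^+ 2 + b ^+ 2) / 2 * (v + v) =
  Num.sqrt (a ^+ 2 + b ^+ 2) * v by field.
apply: euclidean_dist_le => /=; first by rewrite mulr_ge0 ?sqrtr_ge0.
rewrite hx hy [leRHS]exprMn sqr_sqrtr ?addr_ge0 ?sqr_ge0//.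
by rewrite le_eqVlt; apply/orP; left; apply/eqP; ring.
Qed.

(* The polygon through the four vertices and one extra point in the first
   quadrant is inscribed in the curve. *)
Lemma perimeter_ge a b s t : 0 < a -> 0 < b -> 0 < s -> 0 < t < pi / 2 ->
  ((euclidean_dist (a, 0) (superellipse a b s t) +
    euclidean_dist (superellipse a b s t) (0, b) +
    3 * Num.sqrt (a ^+ 2 + b ^+ 2))%:E <= perimeter a b s)%E.
Proof.
move=> a0 b0 s0 /andP[t0 tp]; have pi0 := @pi_gt0 R.
(* The angles are written as repeated sums so that [superellipse_rotate] computes the vertices. *)
pose l := [:: t; pi / 2; pi / 2 + pi / 2; pi / 2 + pi / 2 + pi / 2;
  pi / 2 + pi / 2 + pi / 2 + pi / 2 : R].
apply: ereal_sup_ubound; exists l.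
  split; last by rewrite /l/=; apply/eqP; field.
  by rewrite /l /= t0 tp !ltrDl !divr_gt0.
congr EFin; rewrite /polygonal_length /l /= !big_nat_recl// big_nil/=.
rewrite !superellipse_rotate superellipse0// !superellipse_pihalf//.
rewrite addr0 -[RHS]addrA; congr (_ + (_ + _)); rewrite /euclidean_dist /rotate /=.
have -> : 3 * Num.sqrt (a ^+ 2 + b ^+ 2) = Num.sqrt (a ^+ 2 + b ^+ 2) +
  (Num.sqrt (a ^+ 2 + b ^+ 2) + Num.sqrt (a ^+ 2 + b ^+ 2)) by ring.
congr (_ + (_ + _)); congr Num.sqrt; ring.
Qed.

(** The projections of the two legs on the direction [(a, - b)] add up to the whole side; off the
    line through the vertices the first leg is not parallel to it, hence strictly longer than its
    projection. *)
Lemma vertex_dist_lt a b x y : 0 < a -> 0 < b -> x / a + y / b != 1 ->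
  Num.sqrt (a ^+ 2 + b ^+ 2) <
  euclidean_dist (a, 0) (x, y) + euclidean_dist (x, y) (0, b).
Proof.
move=> a0 b0 xy1; rewrite /euclidean_dist/= sub0r subr0.
set N := Num.sqrt (a ^+ 2 + b ^+ 2).
have N0 : 0 < N by rewrite sqrtr_gt0 addr_gt0// exprn_gt0.
have NN : N ^+ 2 = a ^+ 2 + b ^+ 2 by rewrite sqr_sqrtr ?addr_ge0 ?sqr_ge0.
rewrite -(ltr_pM2l N0) -expr2 NN mulrDr.
have h1 : a * (a - x) + b * y < N * Num.sqrt ((a - x) ^+ 2 + y ^+ 2).
  apply: dot_lt_sqrt; apply: contra_neq xy1 => e.
  apply: (mulfI (lt0r_neq0 (mulr_gt0 a0 b0))).
  rewrite mulr1 mulrDr (_ : a * b * (y / b) = a * y); last first.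
    by field; rewrite gt_eqF.
  by rewrite e; field; rewrite gt_eqF.
have h2 := dot_le_sqrt a b x (b - y).
by move: h1 h2; rewrite -[(y - b) ^+ 2]sqrrN opprB -/N sqrrN; nra.
Qed.

(** On the open unit interval, raising to the power [s] strictly increases every number if [s < 1]
    and strictly decreases it if [s > 1], so the two sums cannot both be 1. *)
Lemma powR_sum_neq1 s x y : 0 < s -> s != 1 -> 0 < x -> 0 < y ->
  x `^ s + y `^ s = 1 -> x + y != 1.
Proof.
move=> s0 s1 x0 y0 e; apply/eqP => xy1.
have x1 : x < 1 by lra.
have y1 : y < 1 by lra.
move: s1; rewrite neq_lt => /orP[s1|s1].
  have lt u : 0 < u -> u < 1 -> u < u `^ s.
    move=> u0 u1; rewrite -[ltLHS]powRr1 ?ltW// /powR gt_eqF// ltr_expR.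
    by rewrite ltr_nM2r// ln_lt0// u0.
  by have := lt _ x0 x1; have := lt _ y0 y1; lra.
have lt u : 0 < u -> u < 1 -> u `^ s < u.
  move=> u0 u1; rewrite -[ltRHS]powRr1 ?ltW// /powR gt_eqF// ltr_expR.
  by rewrite ltr_nM2r// ln_lt0// u0.
by have := lt _ x0 x1; have := lt _ y0 y1; lra.
Qed.

Lemma perimeter_fin_num a b s : 0 < a -> 0 < b -> 0 < s ->
  perimeter a b s \is a fin_num.
Proof.
move=> a0 b0 s0; rewrite ge0_fin_numE.
  apply: le_lt_trans (ltry (8 * (a + b))); apply: perimeter_le => //.
    exact: lame_chord_bound_add.
  by rewrite addrC; exact: lame_chord_bound_add.
have tp : 0 < (pi / 4 : R) < pi / 2 by have := @pi_gt0 R; lra.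
apply: le_trans (perimeter_ge a0 b0 s0 tp).
by rewrite lee_fin !addr_ge0 ?euclidean_dist_ge0// mulr_ge0 ?sqrtr_ge0.
Qed.

Lemma perimeter_gt a b s : 0 < a -> 0 < b -> 0 < s -> s != 1 ->
  ((4 * Num.sqrt (a ^+ 2 + b ^+ 2))%:E < perimeter a b s)%E.
Proof.
move=> a0 b0 s0 s1; have pi0 := @pi_gt0 R.
(* The extra vertex is taken at angle [pi / 4], where both coordinates are positive. *)
have tp : 0 < (pi / 4 : R) < pi / 2 by lra.
have ct : 0 < cos (pi / 4 : R) by apply: cos_gt0_pihalf; lra.
have st : 0 < sin (pi / 4 : R) by apply: sin_gt0_pihalf; lra.
have [_ _ e] := superellipse_lame_point a0 b0 s0 (ltW ct) (ltW st).
have r0 := superellipse_radius_gt0 (pi / 4) a0 b0 s0.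
have := powR_sum_neq1 s0 s1 _ _ e.
rewrite /= !divr_gt0 ?mulr_gt0// => /(_ isT isT) ne.
apply: lt_le_trans (perimeter_ge a0 b0 s0 tp); rewrite lte_fin.
have := vertex_dist_lt a0 b0 ne; rewrite -/(superellipse a b s (pi / 4)); lra.
Qed.

Lemma perimeter1 a b : 0 < a -> 0 < b ->
  perimeter a b 1 = (4 * Num.sqrt (a ^+ 2 + b ^+ 2))%:E.
Proof.
move=> a0 b0; apply/eqP; rewrite eq_le; apply/andP; split.
  rewrite (_ : 4 * _ = 8 * (Num.sqrt (a ^+ 2 + b ^+ 2) / 2)); last by field.
  apply: perimeter_le => //; first exact: lame_chord_bound1.
  by rewrite [a ^+ 2 + _]addrC; exact: lame_chord_bound1.
have tp : 0 < (pi / 4 : R) < pi / 2 by have := @pi_gt0 R; lra.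
apply: le_trans (perimeter_ge a0 b0 ltr01 tp); rewrite lee_fin.
have := euclidean_dist_triangle (superellipse a b 1 (pi / 4)) (a, 0) (0, b).
by rewrite {1}/euclidean_dist/= subr0 sub0r sqrrN; lra.
Qed.

End superellipse.

(** * The binomial series *)

(* Locked because [rewrite mulr_ge0], [normrM], ... would otherwise see through
   the definition and split the coefficient. *)
HB.lock Definition binom_coef {R : realType} (q : R) (k : nat) : R :=
  pochhammer q k / k`!%:R.

Section binomial_series.
Context {R : realType}.
Implicit Types (q p x y rho : R) (n k : nat).

Lemma pochhammerS q k : pochhammer q k.+1 = pochhammer q k * (q + k%:R).
Proof. by rewrite /pochhammer big_ord_recr. Qed.

Lemma pochhammerSl q k : pochhammer q k.+1 = q * pochhammer (q + 1) k.
Proof.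
rewrite /pochhammer big_ord_recl addr0; congr (_ * _); apply: eq_bigr => i _.
by rewrite lift0 -natr1; ring.
Qed.

Lemma pochhammer_gt0 q k : 0 < q -> 0 < pochhammer q k.
Proof. by move=> q0; apply: prodr_gt0 => i _; rewrite ltr_wpDr. Qed.

Lemma binom_coef0 q : binom_coef q 0 = 1.
Proof. by rewrite binom_coef.unlock /pochhammer big_ord0 fact0 divr1. Qed.

Lemma binom_coef_gt0 q k : 0 < q -> 0 < binom_coef q k.
Proof.
move=> q0.
by rewrite binom_coef.unlock divr_gt0 ?pochhammer_gt0// ltr0n fact_gt0.
Qed.

Lemma binom_coefS q k :
  k.+1%:R * binom_coef q k.+1 = (q + k%:R) * binom_coef q k.
Proof.
rewrite binom_coef.unlock pochhammerS factS natrM invfM.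
rewrite mulrCA [_ * (_^-1 * _)]mulrA divff ?pnatr_eq0// mul1r; ring.
Qed.

Lemma binom_coefSl q k :
  k.+1%:R * binom_coef q k.+1 = q * binom_coef (q + 1) k.
Proof.
rewrite binom_coef.unlock pochhammerSl factS natrM invfM.
by rewrite mulrCA [_ * (_^-1 * _)]mulrA divff ?pnatr_eq0// mul1r -mulrA.
Qed.

Lemma binom_coef_pascal q k :
  binom_coef q k.+1 + binom_coef (q + 1) k = binom_coef (q + 1) k.+1.
Proof.
have k0 : k.+1%:R != 0 :> R by rewrite pnatr_eq0.
apply: (mulfI k0); rewrite mulrDr binom_coefSl binom_coefS -natr1; ring.
Qed.

Lemma normr_binom_coef p q k : `|p| <= q -> `|binom_coef p k| <= binom_coef q k.
Proof.
move=> pq; rewrite binom_coef.unlock normrM normfV normr_nat ler_wpM2r ?invr_ge0//.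
rewrite /pochhammer normr_prod; apply: ler_prod => i _; rewrite normr_ge0/=.
by rewrite (le_trans (ler_normD _ _))// normr_nat lerD2r.
Qed.

(** Truncation of the binomial series of [1 - y] to the power [- q]. *)
Definition binom_sum q n y : R := \sum_(0 <= k < n) binom_coef q k * y ^+ k.

Lemma binom_sumS q n y :
  binom_sum q n.+1 y = binom_sum q n y + binom_coef q n * y ^+ n.
Proof. by rewrite /binom_sum big_nat_recr. Qed.

Lemma binom_sum0 q n : binom_sum q n.+1 0 = 1.
Proof.
elim: n => [|n ih]; rewrite binom_sumS ?ih ?exprS ?mul0r ?mulr0 ?addr0//.
by rewrite /binom_sum big_nil add0r binom_coef0 mulr1.
Qed.

(** For the full series the difference is 0; truncation leaves a single monomial, by Pascal's
    rule. *)
Lemma binom_sum_pascal q n y :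
  binom_sum q n.+1 y - (1 - y) * binom_sum (q + 1) n y =
  binom_coef (q + 1) n * y ^+ n.
Proof.
elim: n => [|n ih].
  by rewrite binom_sumS /binom_sum !big_nil !binom_coef0; ring.
rewrite binom_sumS (binom_sumS (q + 1)) -binom_coef_pascal.
have -> : binom_sum q n.+1 y = binom_coef (q + 1) n * y ^+ n +
  (1 - y) * binom_sum (q + 1) n y by rewrite -ih; ring.
rewrite exprS; ring.
Qed.

Lemma is_derive_binom_sum q n y :
  is_derive y 1 (binom_sum q n.+1) (q * binom_sum (q + 1) n y).
Proof.
elim: n => [|n ih].
  have -> : binom_sum q 1 = cst 1.
    by apply/funext => z; rewrite binom_sumS /binom_sum big_nil binom_coef0/=; ring.
  by rewrite /binom_sum big_nil mulr0; exact: is_derive_cst.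
have -> : binom_sum q n.+2 =
    binom_sum q n.+1 + (fun z => binom_coef q n.+1 * z ^+ n.+1).
  by apply/funext => z; rewrite binom_sumS.
have dX : is_derive y 1 (fun z : R => z ^+ n.+1) (n.+1%:R * y ^+ n).
  by split; [exact: exprn_derivable|rewrite exp_derive [LHS]mulr1].
apply: (is_derive_eq (is_deriveD ih (is_deriveZ (binom_coef q n.+1) dX))).
rewrite binom_sumS /GRing.scale/= mulrDr; congr (_ + _).
by rewrite [RHS]mulrA -binom_coefSl mulrCA -[RHS]mulrA.
Qed.

Lemma is_derive_powR1B p y : y < 1 ->
  is_derive y 1 (fun z => (1 - z) `^ p) (- (p * (1 - y) `^ (p - 1))).
Proof.
move=> y1; have y0 : 0 < 1 - y by rewrite subr_gt0.
have dB : is_derive y 1 (fun z : R => 1 - z) (- 1).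
  have := is_deriveB (is_derive_cst (1 : R) y (1 : R)) (is_derive_id y (1 : R)).
  by rewrite sub0r.
have h := @is_derive1_comp _ (fun z : R => z `^ p) (fun z : R => 1 - z) y _ _
  (is_derive1_powR p y0) dB.
apply: (is_derive_eq h).
by rewrite mulrN1.
Qed.

(** The product would be constantly 1 for the full series; for the truncation, [binom_sum_pascal]
    cancels all of the derivative but one monomial. *)
Lemma is_derive_binom_prod q n y : y < 1 ->
  is_derive y 1 (fun z => (1 - z) `^ q * binom_sum q n.+1 z)
    (- (q * (1 - y) `^ (q - 1) * (binom_coef (q + 1) n * y ^+ n))).
Proof.
move=> y1; have y0 : 0 < 1 - y by rewrite subr_gt0.
apply: (is_derive_eq
  (is_deriveM (is_derive_powR1B q y1) (is_derive_binom_sum q n y))).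
rewrite /GRing.scale/= -binom_sum_pascal.
have -> : (1 - y) `^ q = (1 - y) * (1 - y) `^ (q - 1).
  rewrite powRB ?(gt_eqF y0) ?implybT// powRr1 ?(ltW y0)//.
  by rewrite [RHS]mulrC divfK ?gt_eqF.
ring.
Qed.

(** An explicit remainder, by the mean value theorem between 0, where the product is 1, and [y] of
    either sign. *)
Lemma binom_prod_MVT q n y : y < 1 ->
  exists2 c : R, [/\ `|c| <= `|y|, c < 1 & 0 <= y -> 0 <= c] &
  (1 - y) `^ q * binom_sum q n.+1 y - 1 =
  - (q * (1 - c) `^ (q - 1) * (binom_coef (q + 1) n * c ^+ n)) * y.
Proof.
move=> y1; pose f z := (1 - z) `^ q * binom_sum q n.+1 z.
pose df z := - (q * (1 - z) `^ (q - 1) * (binom_coef (q + 1) n * z ^+ n)).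
have f0 : f 0 = 1 by rewrite /f subr0 powR1 binom_sum0 mulr1.
have fd (u v : R) : v < 1 -> forall z, z \in `]u, v[%R -> is_derive z 1 f (df z).
  move=> v1 z; rewrite in_itv/= => /andP[_ zv].
  exact/is_derive_binom_prod/(lt_trans zv).
have fc (u v : R) : v < 1 -> {within `[u, v], continuous f}.
  move=> v1; apply: continuous_in_subspaceT => z; rewrite inE/= in_itv/= => /andP[_ zv].
  have [/derivable1_diffP/differentiable_continuous h _] :=
    is_derive_binom_prod q n (le_lt_trans zv v1).
  exact: h.
rewrite -/(f y); have [y0|/ltW y0] := leP 0 y.
  have [c + e] := MVT_segment y0 (fd 0 y y1) (fc 0 y y1).
  rewrite in_itv/= => /andP[c0 cy]; exists c.
    by rewrite !ger0_norm//; split => //; exact: le_lt_trans y1.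
  by rewrite -[X in _ - X]f0 e subr0.
have [c + e] := MVT_segment y0 (fd y 0 ltr01) (fc y 0 ltr01).
rewrite in_itv/= => /andP[yc c0]; exists c.
  rewrite !ler0_norm// lerN2; split; [by []|exact: le_lt_trans ltr01|].
  by move=> y0'; exact: le_trans yc.
by rewrite -[X in _ - X]f0 -[LHS]opprB e sub0r mulrN opprK.
Qed.

(** A term is at most the partial sum of nonnegative terms, and the sign of the remainder in
    [binom_prod_MVT] puts the partial sum below the limit. *)
Lemma binom_coef_exprn_le q n y : 0 < q -> 0 <= y < 1 ->
  binom_coef q n * y ^+ n <= (1 - y) `^ (- q).
Proof.
move=> q0 /andP[y0 y1].
have y10 : 0 < 1 - y by rewrite subr_gt0.
apply: (@le_trans _ _ (binom_sum q n.+1 y)).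
  rewrite binom_sumS lerDr sumr_ge0// => i _.
  by rewrite mulr_ge0 ?exprn_ge0// ltW// binom_coef_gt0.
rewrite powRN -[leRHS]mul1r ler_pdivlMr ?powR_gt0// mulrC -subr_le0.
have [c [_ c1 /(_ y0) c0] ->] := binom_prod_MVT q n y1.
rewrite mulNr oppr_le0 !mulr_ge0 ?powR_ge0 ?exprn_ge0//; first exact: ltW.
by rewrite ltW// binom_coef_gt0// ltr_wpDr.
Qed.

Lemma powR_le_two_sided p x m : 0 < m -> m <= x <= 2 ->
  x `^ p <= 2 `^ `|p| + m `^ (- `|p|).
Proof.
move=> m0 /andP[mx x2]; have x0 := lt_le_trans m0 mx.
have [x1|/ltW x1] := leP 1 x.
  rewrite (@le_trans _ _ (2 `^ `|p|)) ?lerDl ?powR_ge0//.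
  apply: (@le_trans _ _ (x `^ `|p|)); first exact: ler_powR (ler_norm _).
  by apply: ge0_ler_powR; rewrite ?nnegrE// ltW.
rewrite (@le_trans _ _ (m `^ (- `|p|))) ?lerDr ?powR_ge0//.
apply: (@le_trans _ _ (x `^ (- `|p|))).
  by apply: ger_powR; rewrite ?x0// lerNl -normrN ler_norm.
rewrite !powRN lef_pV2 ?posrE ?powR_gt0//.
by apply: ge0_ler_powR; rewrite ?nnegrE// ltW.
Qed.

(** Cauchy-type estimate: at a radius [r'] strictly between [rho] and 1, [binom_coef_exprn_le]
    bounds the coefficients by a multiple of the inverse powers of [r'], so the remainder decays
    like the powers of [rho / r']. *)
Lemma binomial_series_unif q rho : 0 <= rho < 1 -> exists C theta : R,
  [/\ 0 <= C, 0 <= theta < 1 & forall n y, `|y| <= rho ->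
    `|binom_sum q n.+1 y - (1 - y) `^ (- q)| <= C * theta ^+ n].
Proof.
move=> /andP[r0 r1]; pose r' := (1 + rho) / 2.
have rr' : rho < r' by rewrite /r'; lra.
have r'1 : r' < 1 by rewrite /r'; lra.
have r'0 : 0 < r' by exact: le_lt_trans rr'.
have m0 : 0 < 1 - rho by rewrite subr_gt0.
pose K p := 2 `^ `|p| + (1 - rho) `^ (- `|p|).
have K0 p : 0 <= K p by rewrite addr_ge0 ?powR_ge0.
pose M := (1 - r') `^ (- (`|q| + 1)).
have M0 : 0 <= M by exact: powR_ge0.
exists (K (- q) * (`|q| * K (q - 1) * M)), (rho / r'); split.
- by rewrite !mulr_ge0.
- by rewrite divr_ge0 ?(ltW r'0)//= ltr_pdivrMr// mul1r.
move=> n y yr.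
have Kle p z : `|z| <= rho -> (1 - z) `^ p <= K p.
  rewrite ler_norml => /andP[z1 z2].
  by apply: powR_le_two_sided => //; apply/andP; split; lra.
have y1 : y < 1 by exact: le_lt_trans (ler_norm _) (le_lt_trans yr r1).
have y10 : 0 < 1 - y by rewrite subr_gt0.
have [c [cy _ _] e] := binom_prod_MVT q n y1.
have -> : binom_sum q n.+1 y - (1 - y) `^ (- q) =
    (1 - y) `^ (- q) * ((1 - y) `^ q * binom_sum q n.+1 y - 1).
  by rewrite mulrBr mulr1 mulrA powRN mulVf ?mul1r// gt_eqF ?powR_gt0.
have cr := le_trans cy yr.
rewrite e !normrM normrN !normrM !(ger0_norm (powR_ge0 _ _)) -!mulrA.
apply: ler_pM; rewrite ?powR_ge0//; [|exact: Kle|].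
  by rewrite !mulr_ge0 ?powR_ge0.
apply: ler_wpM2l => //; apply: ler_pM; rewrite ?powR_ge0//; first exact: Kle.
rewrite -[leRHS]mulr1 mulrA; apply: ler_pM; rewrite ?mulr_ge0//; last first.
  exact: le_trans yr (ltW r1).
rewrite normrX; apply: (@le_trans _ _ (binom_coef (`|q| + 1) n * rho ^+ n)).
  apply: ler_pM => //; last by rewrite lerXn2r ?nnegrE.
  apply: normr_binom_coef; rewrite (le_trans (ler_normD _ _))// normr1//.
rewrite -[X in X ^+ n](@divfK _ r') ?gt_eqF// exprMn mulrCA mulrC.
apply: ler_wpM2r; first by rewrite exprn_ge0// divr_ge0// ltW.
by apply: binom_coef_exprn_le; rewrite ?(ltW r'0)// ltr_wpDl.
Qed.

End binomial_series.

(** * Integration over the unit interval *)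

Local Notation "'I01' f" :=
  (\int[lebesgue_measure]_(x in `[0%R, 1%R]) f x)%R (at level 10, f at level 9).

Section unit_interval_integrals.
Context {R : realType}.
Implicit Types (f g h : R -> R) (p q r x y : R) (n k : nat).

Local Notation mu := (@lebesgue_measure R).
(** Unlike integrability, which it implies, this condition is stable under products. *)
Definition bounded_mfun01 f : Prop := measurable_fun (`[0, 1] : set R) f /\
  exists B : R, forall x, 0 <= x <= 1 -> `|f x| <= B.

Lemma lebesgue_measure01 : mu `[0, 1] = 1%:E.
Proof. by rewrite lebesgue_measure_itv/= lte_fin ltr01 oppr0 adde0. Qed.

Lemma bounded_mfun01_integrable f : bounded_mfun01 f ->
  mu.-integrable `[0, 1] (EFin \o f).
Proof.
move=> [mf [B fB]]; apply: measurable_bounded_integrable => //.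
  by rewrite [X in (X < _)%E]lebesgue_measure01 ltry.
exists B; split; first exact: num_real.
by move=> M BM x /=; rewrite in_itv/= => /fB /le_trans; apply; exact: ltW.
Qed.

Lemma bounded_mfun01D f g : bounded_mfun01 f -> bounded_mfun01 g ->
  bounded_mfun01 (fun x => f x + g x).
Proof.
move=> [mf [B fB]] [mg [C gC]]; split; first exact: measurable_funD.
exists (B + C) => x x01; rewrite (le_trans (ler_normD _ _))// lerD// ?fB ?gC//.
Qed.

Lemma bounded_mfun01M f g : bounded_mfun01 f -> bounded_mfun01 g ->
  bounded_mfun01 (fun x => f x * g x).
Proof.
move=> [mf [B fB]] [mg [C gC]]; split; first exact: measurable_funM.
by exists (B * C) => x x01; rewrite normrM ler_pM// ?fB ?gC.
Qed.

Lemma bounded_mfun01_cst (c : R) : bounded_mfun01 (fun=> c).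
Proof. by split; [exact: measurable_cst|exists `|c|]. Qed.

Lemma bounded_mfun01X f n : bounded_mfun01 f ->
  bounded_mfun01 (fun x => f x ^+ n).
Proof.
move=> bf; elim: n => [|n ih]; first exact: bounded_mfun01_cst.
by under eq_fun do rewrite exprS; exact: bounded_mfun01M.
Qed.

Lemma bounded_mfun01_powR p : 0 <= p -> bounded_mfun01 (fun x => x `^ p).
Proof.
move=> p0; split; first by apply: measurable_funTS; exact: measurable_powR.
exists 1 => x /andP[x0 x1]; rewrite ger0_norm ?powR_ge0//.
have -> : 1 = 1 `^ p :> R by rewrite powR1.
by apply: ge0_ler_powR; rewrite ?nnegrE.
Qed.

Lemma bounded_mfun01_powR_comp f p (m : R) : 0 < m -> bounded_mfun01 f ->
  (forall x, 0 <= x <= 1 -> m <= f x <= 2) ->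
  bounded_mfun01 (fun x => f x `^ p).
Proof.
move=> m0 [mf _] fm; split.
  exact: (measurableT_comp (measurable_powR p) mf).
exists (2 `^ `|p| + m `^ (- `|p|)) => x /fm fx.
by rewrite ger0_norm ?powR_ge0//; exact: powR_le_two_sided.
Qed.

Lemma eq_I01 f g : (forall x, 0 <= x <= 1 -> f x = g x) -> I01 f = I01 g.
Proof.
by move=> fg; apply: eq_Rintegral => x; rewrite inE/= in_itv/=; exact: fg.
Qed.

Lemma I01D f g : bounded_mfun01 f -> bounded_mfun01 g ->
  I01 (fun x => f x + g x) = I01 f + I01 g.
Proof. by move=> bf bg; rewrite RintegralD//; exact: bounded_mfun01_integrable. Qed.

Lemma I01Z f (c : R) : bounded_mfun01 f -> I01 (fun x => c * f x) = c * I01 f.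
Proof. by move=> bf; rewrite RintegralZl//; exact: bounded_mfun01_integrable. Qed.

Lemma le_I01 f g : bounded_mfun01 f -> bounded_mfun01 g ->
  (forall x, 0 <= x <= 1 -> f x <= g x) -> I01 f <= I01 g.
Proof.
move=> bf bg fg.
by apply: le_Rintegral => //; exact: bounded_mfun01_integrable.
Qed.

Lemma I01_cst (c : R) : I01 (fun=> c) = c.
Proof. by rewrite Rintegral_cst// [X in fine X]lebesgue_measure01/= mulr1. Qed.

Lemma normr_I01_le f (B : R) : bounded_mfun01 f ->
  (forall x, 0 <= x <= 1 -> `|f x| <= B) -> `|I01 f| <= B.
Proof.
move=> bf fB; rewrite ler_norml -{2}(I01_cst B) -(I01_cst (- B)).
apply/andP; split; apply: le_I01 => //; try exact: bounded_mfun01_cst;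
  by move=> x /fB; rewrite ler_norml => /andP[].
Qed.

(** Both claims are proved in one induction, since additivity of the integral requires the first. *)
Lemma I01_binom_sum q (y h : R -> R) n : bounded_mfun01 y -> bounded_mfun01 h ->
  bounded_mfun01 (fun x => binom_sum q n (y x) * h x) /\
  I01 (fun x => binom_sum q n (y x) * h x) =
  series (fun k => binom_coef q k * I01 (fun x => y x ^+ k * h x)) n.
Proof.
move=> by_ bh; elim: n => [|n [bs ih]].
  rewrite /series/= big_nil; have e x : binom_sum q 0 (y x) * h x = 0.
    by rewrite /binom_sum big_nil mul0r.
  under eq_fun do rewrite e; split; first exact: bounded_mfun01_cst.
  exact: I01_cst.
have e x : binom_sum q n.+1 (y x) * h x =
    binom_sum q n (y x) * h x + binom_coef q n * (y x ^+ n * h x).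
  by rewrite binom_sumS mulrDl -mulrA.
have byn := bounded_mfun01M (bounded_mfun01X n by_) bh.
have bc := bounded_mfun01M (bounded_mfun01_cst (binom_coef q n)) byn.
under eq_fun do rewrite e; split; first exact: bounded_mfun01D.
by rewrite I01D// I01Z// ih seriesSr.
Qed.

Lemma binomial_series_I01 q (rho : R) (y h : R -> R) : 0 <= rho < 1 ->
  bounded_mfun01 y -> bounded_mfun01 h ->
  (forall x, 0 <= x <= 1 -> `|y x| <= rho) ->
  series (fun k => binom_coef q k * I01 (fun x => y x ^+ k * h x)) @ \oo -->
  I01 (fun x => (1 - y x) `^ (- q) * h x).
Proof.
move=> r01 by_ bh yr; have [C [theta [C0 t01 Ct]]] := binomial_series_unif q r01.
have [_ [B hB]] := bh.
have bp : bounded_mfun01 (fun x => (1 - y x) `^ (- q)).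
  apply: (@bounded_mfun01_powR_comp _ _ (1 - rho)).
  - by rewrite subr_gt0; case/andP: r01.
  - apply: bounded_mfun01D; first exact: bounded_mfun01_cst.
    under eq_fun do rewrite -mulN1r.
    by apply: bounded_mfun01M => //; exact: bounded_mfun01_cst.
  - by move=> x /yr; rewrite ler_norml => /andP[? ?]; move: r01 => /andP[? ?];
      apply/andP; split; lra.
(* The uniform estimate concerns the partial sums of index [n.+1]. *)
rewrite -cvg_shiftS.
apply/cvgrPdist_le => eps eps0.
have ct : C * theta ^+ n * B @[n --> \oo] --> (0 : R).
  rewrite -(mul0r B); apply: cvgMr_tmp; rewrite -(mulr0 C); apply: cvgMl_tmp.
  apply: cvg_expr; rewrite ger0_norm; by case/andP: t01.
have /cvgrPdist_le/(_ _ eps0) := ct; apply: filterS => n /=.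
rewrite sub0r normrN => ctn.
have [bs <-] := I01_binom_sum q n.+1 by_ bh.
have bN := bounded_mfun01M (bounded_mfun01_cst (-1)) bs.
have bph := bounded_mfun01M bp bh.
have -> : forall a b, a - b = a + (-1) * b :> R by move=> *; ring.
rewrite -I01Z// -I01D//.
apply: (le_trans _ (le_trans (ler_norm _) ctn)).
apply: normr_I01_le; first exact: bounded_mfun01D.
move=> x x01; rewrite mulrA -mulrDl normrM; apply: ler_pM => //; last exact: hB.
rewrite mulN1r distrC; exact/Ct/yr.
Qed.

End unit_interval_integrals.

(** * Explicit integrals from elementary primitives *)

Section unit_interval_FTC.
Context {R : realType}.
Implicit Types (f F : R -> R) (p q c x y : R).

(** At 0 only right limits are asked for, as powers of [x] need not be derivable there;
    differentiability beyond 1 gives the left limit at 1. *)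
Lemma I01_FTC f F :
  (forall x, 0 < x -> is_derive x 1 F (f x)) ->
  (forall x, 0 < x -> {for x, continuous f}) ->
  F x @[x --> 0^'+] --> F 0 -> f x @[x --> 0^'+] --> f 0 ->
  I01 f = F 1 - F 0.
Proof.
move=> dF cf F0 f0; rewrite /Rintegral (@continuous_FTC2 _ f F)//.
- apply/continuous_within_itvP => //; split => //.
    by move=> x; rewrite in_itv/= => /andP[x0 _]; exact: cf.
  exact/cvg_at_left_filter/cf.
- split => //.
    by move=> x; rewrite in_itv/= => /andP[/dF[]].
  apply: cvg_at_left_filter; apply: differentiable_continuous.
  by apply/derivable1_diffP; have [] := dF _ (@ltr01 R).
- by move=> x; rewrite in_itv/= => /andP[/dF[_ h] _]; rewrite derive1E.
Qed.

Lemma continuous_powR p x : 0 < x -> {for x, continuous (fun y : R => y `^ p)}.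
Proof.
move=> /(is_derive1_powR p)[d _]; apply: differentiable_continuous.
exact/derivable1_diffP.
Qed.

Lemma cvg_powR_right0 p : 0 <= p -> x `^ p @[x --> 0^'+] --> (0 : R) `^ p.
Proof.
rewrite le_eqVlt => /predU1P[<-|p0].
  by under eq_fun do rewrite powRr0; rewrite powRr0; exact: cvg_cst.
by rewrite powR0 ?gt_eqF//; exact: powR_cvg0.
Qed.

Lemma beta_powR0 p : 0 <= p -> I01 (fun x => x `^ p) = (p + 1)^-1.
Proof.
move=> p0; have p1 : 0 < p + 1 by rewrite ltr_wpDl.
apply: etrans; [apply: (@I01_FTC (fun x => x `^ p)
  (fun x => (p + 1)^-1 * x `^ (p + 1)))|].
- move=> x x0; have d := is_derive1_powR (p + 1) x0.
  apply: (is_derive_eq (is_deriveZ (p + 1)^-1 d)).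
  by rewrite /GRing.scale/= addrK mulrA mulVf ?mul1r// gt_eqF.
- by move=> x; exact: continuous_powR.
- by apply: cvgMl_tmp; apply: cvg_powR_right0; exact: ltW.
- exact: cvg_powR_right0.
- by rewrite /= powR1 powR0 ?gt_eqF// mulr1 mulr0 subr0.
Qed.

(** The integrands that remain at [e = 1] once the square roots are replaced by their bounds. *)
Definition powR_kernel q p c x : R := x `^ p * (1 + x `^ q) `^ c.

Lemma is_derive_powR_kernel q p c x : 0 < x ->
  is_derive x 1 (powR_kernel q p c)
    (p * powR_kernel q (p - 1) c x +
     c * q * powR_kernel q (p + q - 1) (c - 1) x).
Proof.
move=> x0; have y0 : 0 < 1 + x `^ q by rewrite ltr_wpDr// powR_ge0.
have d1 : is_derive x 1 (fun z : R => 1 + z `^ q) (q * x `^ (q - 1)).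
  have := is_deriveD (is_derive_cst (1 : R) x (1 : R)) (is_derive1_powR q x0).
  by rewrite add0r.
have d2 := @is_derive1_comp _ (fun z : R => z `^ c) (fun z : R => 1 + z `^ q) x _ _
  (is_derive1_powR c y0) d1.
apply: (is_derive_eq (is_deriveM (is_derive1_powR p x0) d2)).
rewrite /GRing.scale/= /powR_kernel.
have -> : x `^ (p + q - 1) = x `^ p * x `^ (q - 1).
  by rewrite -powRD ?(gt_eqF x0) ?implybT// addrA.
ring.
Qed.

Lemma continuous_powR_kernel q p c x : 0 < x ->
  {for x, continuous (powR_kernel q p c)}.
Proof.
move=> /(is_derive_powR_kernel q p c)[d _]; apply: differentiable_continuous.
exact/derivable1_diffP.
Qed.

Lemma cvg_powR_kernel_right0 q p c : 0 < q -> 0 <= p ->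
  powR_kernel q p c x @[x --> 0^'+] --> powR_kernel q p c 0.
Proof.
move=> q0 p0; apply: cvgM; first exact: cvg_powR_right0.
apply: (@cvg_comp _ _ _ (fun x => 1 + x `^ q) (fun y : R => y `^ c)).
  by apply: cvgD; [exact: cvg_cst|exact/cvg_powR_right0/ltW].
by apply: continuous_powR; rewrite powR0 ?gt_eqF// addr0.
Qed.

(** Substitution of [1 + x ^ q]: the integrand is its derivative times a power of it. *)
Lemma I01_powR_kernel_q q c : 1 <= q -> c != 0 ->
  I01 (powR_kernel q (q - 1) (c - 1)) = (2 `^ c - 1) / (c * q).
Proof.
move=> q1 c0; have q0 : 0 < q by exact: lt_le_trans q1.
have cq : c * q != 0 by rewrite mulf_neq0// gt_eqF.
apply: etrans; [apply: (@I01_FTC (powR_kernel q (q - 1) (c - 1))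
  (fun x => (c * q)^-1 * powR_kernel q 0 c x))|].
- move=> x x0.
  apply: (is_derive_eq (is_deriveZ (c * q)^-1 (is_derive_powR_kernel q 0 c x0))).
  by rewrite /GRing.scale/= mul0r !add0r mulrA mulVf// mul1r.
- by move=> x; exact: continuous_powR_kernel.
- by apply: cvgMl_tmp; exact: cvg_powR_kernel_right0.
- by apply: cvg_powR_kernel_right0 => //; rewrite subr_ge0.
- rewrite /powR_kernel/= !powRr0 !mul1r powR1 powR0 ?gt_eqF// addr0 powR1.
  by rewrite -[1 + 1]/2 mulr1 mulrBl mul1r mulrC.
Qed.

Lemma I01_powR_kernel_p q p : 0 < q -> 1 <= p ->
  I01 (powR_kernel q (p - 1) (- (p / q) - 1)) = 2 `^ (- (p / q)) / p.
Proof.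
move=> q0 p1; have p0 : 0 < p by exact: lt_le_trans p1.
apply: etrans; [apply: (@I01_FTC (powR_kernel q (p - 1) (- (p / q) - 1))
  (fun x => p^-1 * powR_kernel q p (- (p / q)) x))|].
- move=> x x0.
  apply: (is_derive_eq (is_deriveZ p^-1 (is_derive_powR_kernel q p (- (p / q)) x0))).
  have y0 : 0 < 1 + x `^ q by rewrite ltr_wpDr// powR_ge0.
  rewrite /GRing.scale/= /powR_kernel.
  have -> : x `^ (p + q - 1) = x `^ (p - 1) * x `^ q.
    by rewrite -powRD ?(gt_eqF x0) ?implybT// addrAC.
  rewrite [(1 + x `^ q) `^ (- (p / q) - 1)]powRB ?(gt_eqF y0) ?implybT//.
  (* The two terms of the derivative merge because [p * (1 + x ^ q) - p * x ^ q = p]. *)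
  rewrite powRr1 ?(ltW y0)//; field.
  by rewrite !gt_eqF.
- by move=> x; exact: continuous_powR_kernel.
- by apply: cvgMl_tmp; apply: cvg_powR_kernel_right0 => //; exact: ltW.
- by apply: cvg_powR_kernel_right0 => //; rewrite subr_ge0.
- rewrite /powR_kernel/= !powR1 (powR0 (lt0r_neq0 p0)) mul0r mulr0 subr0 mul1r.
  by rewrite mulrC.
Qed.

End unit_interval_FTC.

(** * Integral representation of the branches *)

Section abel_regularized_branches.
Context {R : realType}.
Implicit Types (p q r x y z e s a b : R) (n k : nat).

Lemma powR01 p x : 0 <= p -> 0 <= x <= 1 -> 0 <= x `^ p <= 1.
Proof.
move=> p0 /andP[x0 x1]; rewrite powR_ge0/=.
have -> : 1 = 1 `^ p :> R by rewrite powR1.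
by apply: ge0_ler_powR; rewrite ?nnegrE.
Qed.

Lemma bounded_mfun01_oneBpowR r : 0 <= r ->
  bounded_mfun01 (fun x => 1 - x `^ r).
Proof.
move=> r0; under eq_fun do rewrite -mulN1r.
apply: bounded_mfun01D; first exact: bounded_mfun01_cst.
by apply: bounded_mfun01M; [exact: bounded_mfun01_cst|exact: bounded_mfun01_powR].
Qed.

(** An Euler Beta integral after the substitution of [x ^ r]. Expanding one factor relates [n.+1] to
    [n] at exponents [p] and [p + r], that is, at [u] and [u + 1]. *)
Lemma beta_powR p r n : 0 <= p -> 0 < r ->
  I01 (fun x => x `^ p * (1 - x `^ r) ^+ n) =
  n`!%:R / (r * pochhammer ((p + 1) / r) n.+1).
Proof.
move=> p0 r0; elim: n p p0 => [|n ih] p p0.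
  rewrite (@eq_I01 _ _ (fun x => x `^ p)) => [|x _]; last by rewrite mulr1.
  rewrite beta_powR0// pochhammerS /pochhammer big_ord0 mul1r addr0 mulrCA.
  by rewrite divff ?gt_eqF// mulr1 mul1r.
have b1 := bounded_mfun01_oneBpowR (ltW r0).
rewrite (@eq_I01 _ _ (fun x => x `^ p * (1 - x `^ r) ^+ n +
    (-1) * (x `^ (p + r) * (1 - x `^ r) ^+ n))) => [|x _]; last first.
  rewrite powRD; last by rewrite gt_eqF// ltr_wpDl.
  by rewrite exprS; ring.
have bX t : 0 <= t -> bounded_mfun01 (fun x => x `^ t * (1 - x `^ r) ^+ n).
  move=> t0; apply: bounded_mfun01M; first exact: bounded_mfun01_powR.
  exact: bounded_mfun01X.
have pr0 : 0 <= p + r by rewrite addr_ge0// ltW.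
rewrite I01D; [|exact: bX|]; last first.
  by apply: bounded_mfun01M; [exact: bounded_mfun01_cst|exact: bX].
rewrite I01Z; last exact: bX.
rewrite !ih//.
set u := (p + 1) / r.
have u0 : 0 < u by rewrite divr_gt0// ltr_wpDl.
have -> : (p + r + 1) / r = u + 1 by rewrite /u; field; rewrite gt_eqF.
rewrite pochhammerSl (pochhammerSl u n.+1) (pochhammerS (u + 1) n) factS natrM.
have P0 : 0 < pochhammer (u + 1) n by rewrite pochhammer_gt0// addr_gt0.
move: P0; set P := pochhammer _ _ => P0.
have un0 : 0 < u + 1 + n%:R by rewrite ltr_wpDr// addr_gt0.
rewrite -natr1; field.
by rewrite !gt_eqF.
Qed.

(** The square root is expanded in powers of [z * (1 - x ^ r)]; Beta integrals turn its binomial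
    coefficients into the hypergeometric ones. *)
Lemma hypergeometric_2F1_I01 p r z : 0 <= p -> 0 < r -> 0 <= z < 1 ->
  hypergeometric_2F1 (- 2^-1) 1 ((p + 1) / r + 1) z =
  (p + 1) * I01 (fun x => (1 - z * (1 - x `^ r)) `^ 2^-1 * x `^ p).
Proof.
move=> p0 r0 /andP[z0 z1]; rewrite /hypergeometric_2F1.
set u := (p + 1) / r; have u0 : 0 < u by rewrite divr_gt0// ltr_wpDl.
have ur : p + 1 = u * r by rewrite /u divfK ?gt_eqF.
have b1 := bounded_mfun01_oneBpowR (ltW r0).
have bz : bounded_mfun01 (fun x => z * (1 - x `^ r)).
  by apply: bounded_mfun01M => //; exact: bounded_mfun01_cst.
have bp := bounded_mfun01_powR p0.
have := @binomial_series_I01 R (- 2^-1) z _ _ _ bz bp _.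
rewrite opprK z0 z1 => /(_ isT) H.
rewrite (_ : (fun n => _) = (fun n => (p + 1) * (binom_coef (- 2^-1) n *
    I01 (fun x => (z * (1 - x `^ r)) ^+ n * x `^ p)))); last first.
  apply/funext => n.
  rewrite (@eq_I01 _ _ (fun x => z ^+ n * (x `^ p * (1 - x `^ r) ^+ n))); last first.
    by move=> x _; rewrite exprMn; ring.
  rewrite I01Z; last by apply: bounded_mfun01M => //; exact: bounded_mfun01X.
  rewrite beta_powR// ur -/u mulfK ?gt_eqF// pochhammerSl binom_coef.unlock.
  have -> : pochhammer 1 n = n`!%:R :> R.
    elim: n => [|n ih]; first by rewrite /pochhammer big_ord0.
    by rewrite pochhammerS ih factS natrM nat1r mulrC.
  have P0 : 0 < pochhammer (u + 1) n by rewrite pochhammer_gt0// addr_gt0.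
  have f0 : n`!%:R != 0 :> R by rewrite pnatr_eq0 -lt0n fact_gt0.
  field; rewrite f0 !gt_eqF//.
apply/cvg_lim => //.
rewrite (_ : series _ = (fun n => (p + 1) * series (fun k =>
    binom_coef (- 2^-1) k * I01 (fun x => (z * (1 - x `^ r)) ^+ k * x `^ p)) n)); last first.
  by apply/funext => n; rewrite /series/= mulr_sumr.
apply: cvgMl_tmp; apply: H => x /(powR01 (ltW r0)) /andP[xr0 xr1].
rewrite ger0_norm; last by rewrite mulr_ge0// subr_ge0.
by rewrite ler_piMr// lerBlDr lerDl.
Qed.

Lemma sqr_ratio01 a b : 0 < a -> 0 < b -> 0 < b ^+ 2 / (a ^+ 2 + b ^+ 2) < 1.
Proof.
move=> a0 b0; have a2 : 0 < a ^+ 2 by rewrite exprn_gt0.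
have b2 : 0 < b ^+ 2 by rewrite exprn_gt0.
by rewrite divr_gt0 ?addr_gt0//= ltr_pdivrMr ?addr_gt0// mul1r ltrDr.
Qed.

(** For [z = b^2 / (a^2 + b^2)] and [w = t^2], this is the sum of the norms of [(a, b * t)] and
    [(a * t, b)] divided by that of [(a, b)]. *)
Definition profile z w : R :=
  (1 - z * (1 - w)) `^ 2^-1 + (1 - (1 - z) * (1 - w)) `^ 2^-1.

Definition abel_integral z q r al e : R :=
  I01 (fun x => (1 + e * x `^ q) `^ (- al) * profile z (x `^ r)).

Lemma bounded_mfun01_sqrt_profile z r : 0 <= z < 1 -> 0 <= r ->
  bounded_mfun01 (fun x => (1 - z * (1 - x `^ r)) `^ 2^-1).
Proof.
move=> /andP[z0 z1] r0; apply: (@bounded_mfun01_powR_comp _ _ _ (1 - z)).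
- by rewrite subr_gt0.
- apply: bounded_mfun01D; first exact: bounded_mfun01_cst.
  under eq_fun do rewrite -mulNr.
  apply: bounded_mfun01M; first exact: bounded_mfun01_cst.
  exact: bounded_mfun01_oneBpowR.
- by move=> x /(powR01 r0) /andP[h0 h1]; apply/andP; split; nra.
Qed.

Lemma bounded_mfun01_profile z r : 0 < z < 1 -> 0 <= r ->
  bounded_mfun01 (fun x => profile z (x `^ r)).
Proof.
move=> /andP[z0 z1] r0.
apply: bounded_mfun01D; apply: bounded_mfun01_sqrt_profile => //; lra.
Qed.

Lemma bounded_mfun01_abel q al e : 0 <= q -> 0 <= e <= 1 ->
  bounded_mfun01 (fun x => (1 + e * x `^ q) `^ (- al)).
Proof.
move=> q0 /andP[e0 e1]; apply: (@bounded_mfun01_powR_comp _ _ _ 1) => //.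
- apply: bounded_mfun01D; first exact: bounded_mfun01_cst.
  by apply: bounded_mfun01M; [exact: bounded_mfun01_cst|exact: bounded_mfun01_powR].
- by move=> x /(powR01 q0) /andP[h0 h1]; apply/andP; split; nra.
Qed.

(** The form of [u] covers both branches. The factor [q * k + 1] from the hypergeometric integral
    cancels against [u k], leaving [r]. *)
Lemma branch_term_I01 a b s (u : nat -> R) q r x k : 0 < a -> 0 < b ->
  0 <= q -> 0 < r -> (forall k, u k = (q * k%:R + 1) / r) ->
  branch_term a b s u x k = r * (binom_coef (1 + s^-1) k *
    I01 (fun t => (x * t `^ q) ^+ k *
      profile (b ^+ 2 / (a ^+ 2 + b ^+ 2)) (t `^ r))).
Proof.
move=> a0 b0 q0 r0 uE; rewrite /branch_term; set z := b ^+ 2 / _.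
have -> : a ^+ 2 / (a ^+ 2 + b ^+ 2) = 1 - z.
  by rewrite /z; field; rewrite gt_eqF// addr_gt0// exprn_gt0.
have /andP[z0 z1] : 0 < z < 1 by exact: sqr_ratio01.
have qk0 : 0 <= q * k%:R by rewrite mulr_ge0.
rewrite uE !hypergeometric_2F1_I01//; try by apply/andP; split; lra.
rewrite -mulrDr -I01D; last 2 first.
- apply: bounded_mfun01M; last exact: bounded_mfun01_powR.
  by apply: bounded_mfun01_sqrt_profile; [apply/andP; split; lra|exact: ltW].
- apply: bounded_mfun01M; last exact: bounded_mfun01_powR.
  by apply: bounded_mfun01_sqrt_profile; [apply/andP; split; lra|exact: ltW].
rewrite [in RHS](@eq_I01 _ _
  (fun t => x ^+ k * (profile z (t `^ r) * t `^ (q * k%:R)))).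
  rewrite I01Z; last first.
    apply: bounded_mfun01M; last exact: bounded_mfun01_powR.
    by apply: bounded_mfun01_profile; [rewrite z0|exact: ltW].
  rewrite binom_coef.unlock.
  rewrite (@eq_I01 _ _ (fun t => profile z (t `^ r) * t `^ (q * k%:R))); last first.
    by move=> t _; rewrite /profile; ring.
  set J := Rintegral _ _ _.
  have qk1 : q * k%:R + 1 != 0 by rewrite gt_eqF// ltr_wpDl.
  have f0 : k`!%:R != 0 :> R by rewrite pnatr_eq0 -lt0n fact_gt0.
  by field; rewrite qk1 f0 gt_eqF.
by move=> t _; rewrite exprMn powRrM powR_mulrn ?powR_ge0//; ring.
Qed.

(** The binomial series is summed at [- e * x ^ q]; [e < 1] keeps this uniformly away from the
    singularity. *)
Lemma cvg_series_branch_term a b s (u : nat -> R) q r e : 0 < a -> 0 < b ->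
  0 <= q -> 0 < r -> (forall k, u k = (q * k%:R + 1) / r) -> 0 < e < 1 ->
  series (branch_term a b s u (- e)) @ \oo -->
  r * abel_integral (b ^+ 2 / (a ^+ 2 + b ^+ 2)) q r (1 + s^-1) e.
Proof.
move=> a0 b0 q0 r0 uE /andP[e0 e1]; set z := b ^+ 2 / _.
have z01 : 0 < z < 1 by exact: sqr_ratio01.
pose t k := binom_coef (1 + s^-1) k *
    I01 (fun t => (- e * t `^ q) ^+ k * profile z (t `^ r)).
rewrite (_ : series _ = fun n => r * series t n); last first.
  apply/funext => n; rewrite /series/= mulr_sumr; apply: eq_bigr => k _.
  by rewrite (branch_term_I01 s _ _ a0 b0 q0 r0 uE).
apply: cvgMl_tmp.
rewrite /abel_integral (@eq_I01 _ _ (fun x =>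
  (1 - (- e) * x `^ q) `^ (- (1 + s^-1)) * profile z (x `^ r))); last by move=> x _; rewrite mulNr opprK.
apply: (@binomial_series_I01 _ _ e).
- by rewrite (ltW e0).
- by apply: bounded_mfun01M; [exact: bounded_mfun01_cst|exact: bounded_mfun01_powR].
- by apply: bounded_mfun01_profile => //; exact: ltW.
- move=> x /(powR01 q0) /andP[h0 h1]; rewrite mulNr normrN ger0_norm.
    by rewrite ler_piMr// ltW.
  by rewrite mulr_ge0// ltW.
Qed.

Lemma profile_ge0 z w : 0 <= profile z w.
Proof. by rewrite addr_ge0 ?powR_ge0. Qed.

(** Squeeze: for [0 < e < 1] and [y >= 0], [1 + e * y] lies between [e * (1 + y)] and [1 + y]. *)
Lemma cvg_abel_integral z q r al : 0 < z < 1 -> 0 <= q -> 0 <= r -> 0 <= al ->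
  abel_integral z q r al e @[e --> 1^'-] --> abel_integral z q r al 1.
Proof.
move=> z01 q0 r0 al0.
have bpr := bounded_mfun01_profile z01 r0.
have b1 : bounded_mfun01 (fun x => (1 + 1 * x `^ q) `^ (- al) * profile z (x `^ r)).
  by apply: bounded_mfun01M => //; apply: bounded_mfun01_abel => //; rewrite ler01/=.
apply: (@squeeze_cvgr _ _ _ _ (fun=> abel_integral z q r al 1)
  (fun e => e `^ (- al) * abel_integral z q r al 1)).
- near=> e.
  have e0 : 0 < e by near: e; apply: nbhs_left_gt; exact: ltr01.
  have e1 : e < 1 by near: e; exact: nbhs_left_lt.
  have be : bounded_mfun01 (fun x => (1 + e * x `^ q) `^ (- al) * profile z (x `^ r)).
    by apply: bounded_mfun01M => //; apply: bounded_mfun01_abel => //; rewrite !ltW.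
  apply/andP; split.
    apply: le_I01 => // x /(powR01 q0) /andP[h0 h1].
    apply: ler_wpM2r; first exact: profile_ge0.
    rewrite !powRN lef_pV2 ?posrE ?powR_gt0//; [|nra|nra].
    by apply: ge0_ler_powR; rewrite ?nnegrE//; nra.
  rewrite -I01Z//; apply: le_I01 => //.
    by apply: bounded_mfun01M => //; exact: bounded_mfun01_cst.
  move=> x /(powR01 q0) /andP[h0 h1]; rewrite mulrA.
  apply: ler_wpM2r; first exact: profile_ge0.
  rewrite -powRM; [|exact: ltW|nra].
  rewrite !powRN lef_pV2 ?posrE ?powR_gt0//; [|nra|nra].
  by apply: ge0_ler_powR; rewrite ?nnegrE//; nra.
- exact: cvg_cst.
- have h : e `^ (- al) @[e --> (1 : R)^'-] --> (1 : R).
    have [/derivable1_diffP/differentiable_continuous h _] :=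
      is_derive1_powR (- al) (@ltr01 R).
    have := @cvg_at_left_filter _ _ _ _ _ h; rewrite powR1; exact.
  have := @cvgMr_tmp _ _ _ _ _ _ (abel_integral z q r al 1) h.
  by rewrite [1 * _]mul1r; exact.
Unshelve. all: by end_near.
Qed.

End abel_regularized_branches.

(** * Bounds on the integrals of both branches *)

Section branch_bounds.
Context {R : realType}.
Implicit Types (p q r x z e s a b t : R) (n k : nat).

(** With [S] the root and [B = 1 - z + z * t] its chord, [S^2 - B^2 = z * (1 - z) * (1 - t)^2];
    dividing by [S + B <= 2] gives the gain over concavity. *)
Lemma sqrt_profile_bounds z t : 0 < z < 1 -> 0 <= t <= 1 ->
  1 - z + z * t + z * (1 - z) * (1 - t) ^+ 2 / 2 <=
  (1 - z * (1 - t ^+ 2)) `^ 2^-1 <= 1.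
Proof.
move=> /andP[z0 z1] /andP[t0 t1]; set A := 1 - z * (1 - t ^+ 2).
have tt : t ^+ 2 <= 1 by rewrite expr_le1.
have tt0 : 0 <= t ^+ 2 by rewrite sqr_ge0.
have A0 : 0 <= A by rewrite /A; nra.
have A1 : A <= 1 by rewrite /A; nra.
rewrite powR12_sqrt//; set S := Num.sqrt A.
have S0 : 0 <= S by exact: sqrtr_ge0.
have SA : S ^+ 2 = A by rewrite sqr_sqrtr.
have S1 : S <= 1 by rewrite -sqrtr1 ler_wsqrtr.
rewrite S1 andbT; set B := 1 - z + z * t; set D := z * (1 - z) * (1 - t) ^+ 2.
have B0 : 0 <= B by rewrite /B; nra.
have B1 : B <= 1 by rewrite /B; nra.
have D0 : 0 <= D by rewrite /D !mulr_ge0 ?sqr_ge0 ?subr_ge0// ltW.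
have e : (S - B) * (S + B) = D.
  by rewrite -subr_sqr SA /A /B /D; ring.
have BS : B <= S.
  rewrite leNgt; apply/negP => SB; nra.
nra.
Qed.

Lemma profile_bounds z t : 0 < z < 1 -> 0 <= t <= 1 ->
  1 + t + z * (1 - z) * (1 - t) ^+ 2 <= profile z (t ^+ 2) <= 2.
Proof.
move=> z01 t01; have z01' : 0 < 1 - z < 1 by lra.
have := sqrt_profile_bounds z01 t01; have := sqrt_profile_bounds z01' t01.
rewrite /profile; set S := _ `^ _; set S' := _ `^ _.
have -> : 1 - (1 - z) = z by ring.
move: ((1 - t) ^+ 2) => T; lra.
Qed.

Lemma bounded_mfun01_powR_kernel q p al : 0 <= q -> 0 <= p ->
  bounded_mfun01 (powR_kernel q p (- al)).
Proof.
move=> q0 p0; apply: bounded_mfun01M; first exact: bounded_mfun01_powR.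
have := @bounded_mfun01_abel R q al 1 q0; rewrite ler01 lexx => /(_ isT).
by under eq_fun do rewrite mul1r.
Qed.

Lemma abel_integral_bounds z q r al : 0 < z < 1 -> 0 <= q -> 0 < r -> 0 <= al ->
  I01 (powR_kernel q 0 (- al)) + I01 (powR_kernel q r (- al)) <
  abel_integral z q (2 * r) al 1 <= 2 * I01 (powR_kernel q 0 (- al)).
Proof.
move=> z01 q0 r0 al0; have r2 : 0 <= 2 * r by rewrite mulr_ge0// ltW.
have bk0 := bounded_mfun01_powR_kernel al q0 (lexx 0).
have bkr := bounded_mfun01_powR_kernel al q0 (ltW r0).
have bJ : bounded_mfun01 (fun x =>
    (1 + 1 * x `^ q) `^ (- al) * profile z (x `^ (2 * r))).
  apply: bounded_mfun01M; last exact: bounded_mfun01_profile.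
  by apply: bounded_mfun01_abel => //; rewrite ler01/=.
have sq x : x `^ (2 * r) = (x `^ r) ^+ 2.
  by rewrite mulrC powRrM powR_mulrn// powR_ge0.
have k0E x : powR_kernel q 0 (- al) x = (1 + 1 * x `^ q) `^ (- al).
  by rewrite /powR_kernel powRr0 !mul1r.
have krE x : powR_kernel q r (- al) x = x `^ r * (1 + 1 * x `^ q) `^ (- al).
  by rewrite /powR_kernel mul1r.
apply/andP; split; last first.
  rewrite -I01Z//; apply: le_I01 => //.
    by apply: bounded_mfun01M => //; exact: bounded_mfun01_cst.
  move=> x /(powR01 (ltW r0)) /(profile_bounds z01) /andP[_].
  rewrite -sq k0E => h; rewrite /= [leRHS]mulrC.
  by apply: ler_wpM2l => //; exact: powR_ge0.
(* The power of 2 is the least value of the weight on the unit interval, so [c] times a positive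
   Beta integral is a strict gain. *)
pose c := z * (1 - z) * 2 `^ (- al).
have z1z : 0 < z * (1 - z) by case/andP: z01 => ? ?; rewrite mulr_gt0// subr_gt0.
have c0 : 0 < c by rewrite mulr_gt0// powR_gt0.
have bb : bounded_mfun01 (fun x => x `^ 0 * (1 - x `^ r) ^+ 2).
  apply: bounded_mfun01M; first exact: bounded_mfun01_powR.
  exact/bounded_mfun01X/bounded_mfun01_oneBpowR/ltW.
have b0 : 0 < I01 (fun x => x `^ 0 * (1 - x `^ r) ^+ 2).
  rewrite beta_powR// add0r divr_gt0// mulr_gt0// pochhammer_gt0//.
  by rewrite divr_gt0.
apply: (@lt_le_trans _ _
    (I01 (powR_kernel q 0 (- al)) + I01 (powR_kernel q r (- al)) +
    c * I01 (fun x => x `^ 0 * (1 - x `^ r) ^+ 2))); first by rewrite ltrDl mulr_gt0.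
have bcb := bounded_mfun01M (bounded_mfun01_cst c) bb.
rewrite -I01Z// -I01D// -I01D//; last exact: bounded_mfun01D.
apply: le_I01 => //; first by apply: bounded_mfun01D => //; exact: bounded_mfun01D.
move=> x x01; have /andP[h _] := profile_bounds z01 (powR01 (ltW r0) x01).
have /andP[q1 q2] := powR01 q0 x01.
rewrite k0E krE powRr0 !mul1r sq.
set w := (1 + x `^ q) `^ (- al).
have w2 : 2 `^ (- al) <= w.
  rewrite /w !powRN lef_pV2 ?posrE ?powR_gt0//; last by nra.
  by apply: ge0_ler_powR; rewrite ?nnegrE//; nra.
have w0 : 0 <= w by exact: powR_ge0.
apply: le_trans (ler_wpM2l w0 h).
rewrite -subr_ge0 /c.
rewrite (_ : _ - _ = z * (1 - z) * (1 - x `^ r) ^+ 2 * (w - 2 `^ (- al))).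
  by apply: mulr_ge0; [rewrite mulr_ge0 ?sqr_ge0// ltW|rewrite subr_ge0].
ring.
Qed.

(** With [q = s] and [r = s - 1] both kernels have elementary primitives, and their integrals add up
    to exactly 1. *)
Lemma abel_integral_plus_bounds z s : 0 < z < 1 -> 1 < s ->
  1 < abel_integral z s (2 * (s - 1)) (1 + s^-1) 1 <= 2 * 2 `^ (- s^-1).
Proof.
move=> z01 s1; have s0 : 0 < s by exact: lt_trans s1.
have s1' : 0 < s - 1 by rewrite subr_gt0.
have al0 : 0 <= 1 + s^-1 by rewrite addr_ge0// invr_ge0 ltW.
have := abel_integral_bounds z01 (ltW s0) s1' al0.
have -> : I01 (powR_kernel s 0 (- (1 + s^-1))) = 2 `^ (- s^-1).
  have := I01_powR_kernel_p s0 (lexx 1).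
  by rewrite subrr div1r divr1 -opprD [_ + 1]addrC.
have -> : I01 (powR_kernel s (s - 1) (- (1 + s^-1))) = 1 - 2 `^ (- s^-1).
  have := @I01_powR_kernel_q R s (- s^-1) (ltW s1).
  rewrite oppr_eq0 invr_eq0 gt_eqF// => /(_ isT).
  rewrite -opprD [_ + 1]addrC => ->.
  by rewrite mulNr mulVf ?gt_eqF// invrN1 mulrN1 opprB.
by rewrite addrC subrK.
Qed.

(** The two primitives exchange roles: now [q = 1] and [r = s^-1 - 1], and the integrals add up to
    [s]. *)
Lemma abel_integral_minus_bounds z s : 0 < z < 1 -> 0 < s < 1 ->
  s < abel_integral z 1 (2 * (s^-1 - 1)) (1 + s^-1) 1 <=
  s * (2 * (1 - 2 `^ (- s^-1))).
Proof.
move=> z01 /andP[s0 s1]; have si1 : 1 < s^-1 by rewrite invf_gt1.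
have s1' : 0 < s^-1 - 1 by rewrite subr_gt0.
have al0 : 0 <= 1 + s^-1 by rewrite addr_ge0// invr_ge0 ltW.
have := abel_integral_bounds z01 ler01 s1' al0.
have -> : I01 (powR_kernel 1 0 (- (1 + s^-1))) = s * (1 - 2 `^ (- s^-1)).
  have := @I01_powR_kernel_q R 1 (- s^-1) (lexx 1).
  rewrite oppr_eq0 invr_eq0 gt_eqF// => /(_ isT).
  rewrite subrr -opprD [_ + 1]addrC => ->.
  by rewrite mulr1 invrN invrK mulrN -mulNr opprB mulrC.
have -> : I01 (powR_kernel 1 (s^-1 - 1) (- (1 + s^-1))) = s * 2 `^ (- s^-1).
  have := I01_powR_kernel_p (@ltr01 R) (ltW si1).
  by rewrite !divr1 -opprD [_ + 1]addrC invrK mulrC.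
by rewrite -mulrDr subrK mulr1 mulrCA.
Qed.

Lemma cvg_abel_branch a b s (u : nat -> R) q r K : 0 < a -> 0 < b -> 0 < s ->
  0 <= q -> 0 < r -> (forall k, u k = (q * k%:R + 1) / r) ->
  (forall e, 0 < e < 1 -> cvgn (series (branch_term a b s u (- e)))) /\
  K * limn (series (branch_term a b s u (- e))) @[e --> 1^'-] -->
    K * (r * abel_integral (b ^+ 2 / (a ^+ 2 + b ^+ 2)) q r (1 + s^-1) 1).
Proof.
move=> a0 b0 s0 q0 r0 uE.
have cu e := @cvg_series_branch_term R a b s u q r e a0 b0 q0 r0 uE.
split; first by move=> e /cu h; apply/cvg_ex; eexists; exact: h.
apply: cvgMl_tmp.
(* The series equals the integral only for [0 < e < 1], which holds near 1 on the left. *)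
apply: (@cvg_trans _
  ((r * abel_integral (b ^+ 2 / (a ^+ 2 + b ^+ 2)) q r (1 + s^-1) e)
  @[e --> 1^'-])).
  apply: near_eq_cvg; near=> e; apply/esym/cvg_lim => //; apply: cu.
  apply/andP; split; near: e; last exact: nbhs_left_lt.
  by apply: nbhs_left_gt; exact: ltr01.
apply: cvgMl_tmp; apply: cvg_abel_integral => //; [|exact: ltW|].
  exact: sqr_ratio01.
by rewrite addr_ge0// invr_ge0 ltW.
Unshelve. all: by end_near.
Qed.

End branch_bounds.

(** * Regularized branches compared with the rhombus *)

Section abel_regularized_perimeter.
Context {R : realType}.
Implicit Types a b s : R.

(** The strict lower bound gives the local minimum; the upper bound tends to it as [s] tends to 1,
    which gives the limit. *)
Lemma L_plus_abel_bounds a b s : 0 < a -> 0 < b -> 1 < s ->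
  L_plus_abel_converges a b s /\
  4 * Num.sqrt (a ^+ 2 + b ^+ 2) < L_plus_abel a b s <=
  4 * Num.sqrt (a ^+ 2 + b ^+ 2) * (2 * 2 `^ (- s^-1)).
Proof.
move=> a0 b0 s1; have s0 : 0 < s by exact: lt_trans s1.
have ab : 0 < a ^+ 2 + b ^+ 2 by rewrite addr_gt0// exprn_gt0.
have z01 := sqr_ratio01 a0 b0.
have r0 : 0 < 2 * (s - 1) by rewrite mulr_gt0// subr_gt0.
have uE k : u_plus s k = (s * k%:R + 1) / (2 * (s - 1)) by [].
have [cu cL] := cvg_abel_branch (2 * Num.sqrt (a ^+ 2 + b ^+ 2) / (s - 1))
  a0 b0 s0 (ltW s0) r0 uE.
split; first by split => //; apply/cvg_ex; eexists; exact: cL.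
rewrite /L_plus_abel; move/cvg_lim : cL => -> //.
set N := Num.sqrt _; have N0 : 0 < N by rewrite sqrtr_gt0.
have := abel_integral_plus_bounds z01 s1; set J := abel_integral _ _ _ _ _.
have -> : 2 * N / (s - 1) * (2 * (s - 1) * J) = 4 * N * J.
  by field; rewrite subr_eq0 gt_eqF.
by rewrite ltr_pMr ?ler_pM2l ?mulr_gt0.
Qed.

Lemma L_minus_abel_bounds a b s : 0 < a -> 0 < b -> 0 < s < 1 ->
  L_minus_abel_converges a b s /\
  4 * Num.sqrt (a ^+ 2 + b ^+ 2) < L_minus_abel a b s <=
  4 * Num.sqrt (a ^+ 2 + b ^+ 2) * (2 * (1 - 2 `^ (- s^-1))).
Proof.
move=> a0 b0 s01; have /andP[s0 s1] := s01.
have ab : 0 < a ^+ 2 + b ^+ 2 by rewrite addr_gt0// exprn_gt0.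
have z01 := sqr_ratio01 a0 b0.
have r0 : 0 < 2 * (s^-1 - 1) by rewrite mulr_gt0// subr_gt0 invf_gt1.
have s1' : 1 - s != 0 by rewrite subr_eq0 gt_eqF.
have s0' : s != 0 by rewrite gt_eqF.
(* Dividing numerator and denominator by [s] brings [u_minus] to the common form with [q = 1]. *)
have uE k : u_minus s k = (1 * k%:R + 1) / (2 * (s^-1 - 1)).
  by rewrite /u_minus; field; rewrite s0' mulN1r s1'.
have [cu cL] := cvg_abel_branch (2 * Num.sqrt (a ^+ 2 + b ^+ 2) / - (s - 1))
  a0 b0 s0 ler01 r0 uE.
split; first by split => //; apply/cvg_ex; eexists; exact: cL.
rewrite /L_minus_abel; move/cvg_lim : cL => -> //.
set N := Num.sqrt _; have N0 : 0 < N by rewrite sqrtr_gt0.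
have := abel_integral_minus_bounds z01 s01; set J := abel_integral _ _ _ _ _.
have -> : 2 * N / - (s - 1) * (2 * (s^-1 - 1) * J) = 4 * N * (J / s).
  by field; rewrite s0' subr_eq0 lt_eqF.
move=> /andP[h1 h2]; rewrite ltr_pMr ?ler_pM2l ?mulr_gt0//.
by rewrite ltr_pdivlMr// mul1r h1 ler_pdivrMr// mulrC.
Qed.

Lemma cvg_two_powRN1V : 2 `^ (- s^-1) @[s --> (1 : R)] --> (2^-1 : R).
Proof.
rewrite -[2^-1]powR_inv1// -[X in _ `^ (- X)]invr1 /powR pnatr_eq0/=.
apply: continuous_cvg; first exact: continuous_expR.
by apply: cvgMr_tmp; apply: cvgN; apply: cvgV; [exact: oner_neq0|exact: cvg_id].
Qed.

End abel_regularized_perimeter.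

Theorem theorem6p1 (R : realType) (a b : R) (a_gt0 : 0 < a) (b_gt0 : 0 < b) :
  [/\ forall s : R, 0 < s -> perimeter a b s \is a fin_num,
      perimeter a b 1 = (4 * Num.sqrt (a ^+ 2 + b ^+ 2))%:E,
      forall s : R, 0 < s -> (perimeter a b 1 <= perimeter a b s)%E,
      forall s : R, 0 < s ->
        ((forall t : R, 0 < t -> (perimeter a b s <= perimeter a b t)%E) <->
         s = 1)
    & [/\ forall s : R, 1 < s -> L_plus_abel_converges a b s,
          forall s : R, 0 < s < 1 -> L_minus_abel_converges a b s
        & exists l : R,
          [/\ L_plus_abel a b s @[s --> 1^'+] --> l,
              L_minus_abel a b s @[s --> 1^'-] --> l
            & strict_local_min (L_abel a b l) 1]]].
Proof.
have min1 s : 0 < s -> (perimeter a b 1 <= perimeter a b s)%E.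
  move=> s0; have [->//|s1] := eqVneq s 1.
  by rewrite perimeter1// ltW// perimeter_gt.
split.
- by move=> s; exact: perimeter_fin_num.
- exact: perimeter1.
- exact: min1.
- move=> s s0; split => [|->]; last exact: min1.
  (* Comparing a minimizer with the rhombus contradicts strictness unless [s = 1]. *)
  move=> /(_ 1 ltr01); apply: contraPP => /eqP s1; apply/negP.
  by rewrite -ltNge perimeter1//; exact: perimeter_gt.
split; [by move=> s /(L_plus_abel_bounds a_gt0 b_gt0)[]|
        by move=> s /(L_minus_abel_bounds a_gt0 b_gt0)[]|].
set N := Num.sqrt (a ^+ 2 + b ^+ 2); exists (4 * N); split.
- apply: (@squeeze_cvgr _ _ _ _ (fun=> 4 * N)
    (fun s => 4 * N * (2 * 2 `^ (- s^-1)))).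
  + near=> s; have s1 : 1 < s by near: s; exact: nbhs_right_gt.
    by have [_ /andP[/ltW -> ->]] := L_plus_abel_bounds a_gt0 b_gt0 s1.
  + exact: cvg_cst.
  + rewrite -[X in _ --> X]mulr1; apply: cvgMl_tmp.
    rewrite -[X in _ --> X](@divff _ 2) ?pnatr_eq0//; apply: cvgMl_tmp.
    exact/cvg_at_right_filter/cvg_two_powRN1V.
- apply: (@squeeze_cvgr _ _ _ _ (fun=> 4 * N)
    (fun s => 4 * N * (2 * (1 - 2 `^ (- s^-1))))).
  + near=> s; have s0 : 0 < s by near: s; apply: nbhs_left_gt; exact: ltr01.
    have s1 : s < 1 by near: s; exact: nbhs_left_lt.
    have s01 : 0 < s < 1 by rewrite s0.
    by have [_ /andP[/ltW -> ->]] := L_minus_abel_bounds a_gt0 b_gt0 s01.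
  + exact: cvg_cst.
  + rewrite -[X in _ --> X]mulr1; apply: cvgMl_tmp.
    have e : 2 * (1 - 2^-1) = 1 :> R by field.
    rewrite -[X in _ --> X]e; apply: cvgMl_tmp; apply: cvgB; first exact: cvg_cst.
    exact/cvg_at_left_filter/cvg_two_powRN1V.
- have l1 : L_abel a b (4 * N) 1 = 4 * N by rewrite /L_abel (ltxx (1 : R)).
  rewrite /strict_local_min l1.
  (* The neighbourhood of 1 must stay among positive [s], where the bounds on the lower branch
     hold. *)
  near=> s; have s0 : 0 < s.
    near: s; apply: nbhs_dnbhs; exact: lt_nbhsr (@ltr01 R).
  have s1 : s != 1 by near: s; exact: nbhs_dnbhs_neq.
  rewrite /L_abel; move: s1; rewrite neq_lt => /orP[s1|s1].
    have s01 : 0 < s < 1 by rewrite s0.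
    rewrite (lt_gtF s1) s1.
    by have [_ /andP[]] := L_minus_abel_bounds a_gt0 b_gt0 s01.
  by rewrite s1; have [_ /andP[]] := L_plus_abel_bounds a_gt0 b_gt0 s1.
Unshelve. all: by end_near.
Qed.
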